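(* Fix $\lambda\ge 0$ and $p\in[0,1)$. Let $G_p$ be the random subgraph of $\mathbb{Z}^2$ determined by Bernoulli site percolation on $\mathbb{Z}^2$ with parameter $p$, with law $\mathbb{P}_p$. Then, $\mathbb{P}_p$-almost surely, the set $\mathcal{G}_\lambda(G_p)$ of infinite-volume Gibbs measures for the hard-core model with activity $\lambda$ on $G_p$ is a singleton set.
   Context: $\mathbb{Z}^2$ denotes the graph with vertex set $\mathbb{Z}^2$ and edges between $u,v$ with $\|u-v\|_1=1$. Bernoulli site percolation: under $\mathbb{P}_p$ the variables $(X_v)_{v\in\mathbb{Z}^2}$ are independent with $\mathbb{P}_p[X_v=1]=p$ and $\mathbb{P}_p[X_v=0]=1-p$. The graph $G_p$ is the subgraph of $\mathbb{Z}^2$ obtained by deleting all vertices $v$ with $X_v=0$ together with every edge containing a deleted vertex. Hard-core model: let $G$ be a locally finite graph with countable vertex set $V$. A set $I\subseteq V$ is independent if no two vertices of $I$ are adjacent; let $\mathcal{I}_G$ be the collection of independent sets, viewed as a subset of $\{0,1\}^V$ with the product $\sigma$-algebra. For finite $\Lambda\subset V$ and $\tau\in\mathcal{I}_G$, the hard-core measure on $\Lambda$ with activity $\lambda$ and boundary condition $\tau$ is the probability measure $\mu^\tau_{\Lambda,\lambda}$ supported on $\{I\in\mathcal{I}_G: I\cap\Lambda^c=\tau\cap\Lambda^c\}$ which gives each such $I$ probability proportional to $\lambda^{|I\cap\Lambda|}$ (with $0^0=1$). $\mathcal{G}_\lambda(G)$ is the set of probability measures $\mu$ on $\mathcal{I}_G$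 satisfying the DLR conditions: for every finite $\Lambda\subset V$, the $\mu$-conditional law of $I\cap\Lambda$ given $I\cap\Lambda^c$ is the law of $I\cap \Lambda$ under $\mu^{\tau}_{\Lambda,\lambda}$ with $\tau=I\cap\Lambda^c$. *)

(* Defs.v *)
From mathcomp Require Import all_boot all_order all_algebra finmap.
From mathcomp Require Import all_classical all_reals all_analysis.
From mathcomp Require Import measurable_realfun.

Set Implicit Arguments.
Unset Strict Implicit.
Unset Printing Implicit Defensive.

Import Order.TTheory GRing.Theory Num.Theory.

Local Open Scope classical_set_scope.
Local Open Scope ring_scope.

(** * Site percolation on Z^2 *)

Definition Z2adj : rel (int * int) :=
  fun u v => `|u.1 - v.1| + `|u.2 - v.2| == 1.

Definition mutually_independent d (Omega : measurableType d) (R : realType)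
    (P : probability Omega R) (I : choiceType) d' (S : measurableType d')
    (X : I -> {RV P >-> S}) : Prop :=
  forall (D : {fset I}) (B : I -> set S),
    (forall v, measurable (B v)) ->
    P (\bigcap_(v in [set` D]) (X v @^-1` B v)) =
    (\prod_(v <- D) P (X v @^-1` B v))%E.

Definition bernoulli_percolation d (Omega : measurableType d) (R : realType)
    (P : probability Omega R) (p : R) (X : int * int -> {RV P >-> bool}) :
    Prop :=
  [/\ mutually_independent X,
      forall v, P (X v @^-1` [set true]) = p%:E &
      forall v, P (X v @^-1` [set false]) = (1 - p)%:E].

(* The graph obtained from Z^2 by deleting the closed vertices: its vertex type
   is the subtype of the vertices [v] with [x v = true]. *)
Definition Gp (x : int * int -> bool) : rel {v : int * int | x v} :=
  fun u v => Z2adj (val u) (val v).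

(* [f] is a version of the conditional probability of [B] given the
   sub-sigma-algebra [F]. *)
Definition cond_prob_version d (T : measurableType d) (R : realType)
    (mu : probability T R) (F : set (set T)) (B : set T) (f : T -> \bar R) :
    Prop :=
  preimage_set_system setT f measurable `<=` F /\
  forall A, F A -> (\int[mu]_(t in A) f t)%E = mu (A `&` B).

(** * The hard-core model on a graph [G] with countable vertex set [V] *)

Section product_sigma_algebra.
Variable V : countType.

(* The sigma-algebra on {0,1}^V generated by the coordinates in [D]. *)
Definition coordinate_events (D : set V) : set (set (V -> bool)) :=
  [set A | exists v b, D v /\ A = [set I | I v = b]].

Definition sigma_coord (D : set V) : set (set (V -> bool)) :=
  <<s coordinate_events D >>.

(* {0,1}^V with the product sigma-algebra. *)
Definition config : Type := g_sigma_algebraType (coordinate_events setT).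

End product_sigma_algebra.

Section hard_core.
Variables (R : realType) (V : countType) (G : rel V) (lambda : R).
Implicit Types (I tau : config V) (L : {fset V}).

Definition indep_sets : set (config V) :=
  [set I | forall u v, I u -> I v -> ~~ G u v].

Definition outside L I : config V := fun v => (v \notin L) && I v.

(* This set is finite and, when [tau] is independent, contains [outside L tau],
   which has weight 1 (also for [lambda = 0], as [0 ^+ 0 = 1]); so the sums
   below are genuine finite sums and the normalizing constant is positive. *)
Definition hc_support L tau : set (config V) :=
  [set I | indep_sets I /\ outside L I = outside L tau].

Definition hc_weight L I : R := lambda ^+ #|` [fset v in L | I v]%fset|.

Definition hc_measure L tau (A : set (config V)) : \bar R :=
  ((\sum_(I \in hc_support L tau `&` A) hc_weight L I) /
   (\sum_(I \in hc_support L tau) hc_weight L I))%:E.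

(* A probability measure on the set of independent sets is represented by a
   probability measure on {0,1}^V giving it mass 1. The events [B] below are
   those of the form {I cap L in B'}, so the second clause is the DLR
   condition for the conditional law of I cap L given I cap L^c. *)
Definition hc_gibbs (mu : probability (config V) R) : Prop :=
  mu indep_sets = 1%E /\
  forall L (B : set (config V)), sigma_coord [set` L] B ->
    cond_prob_version mu (sigma_coord (~` [set` L])) B
      (fun I => hc_measure L (outside L I) B).

(* A [probability] of the library is a function on all sets, whose values on
   non-measurable sets are unconstrained; two of them are the same
   mathematical measure when they agree on measurable sets. *)
Definition hc_gibbs_singleton : Prop :=
  exists2 mu : probability (config V) R, hc_gibbs mu &
    forall nu : probability (config V) R, hc_gibbs nu ->
      forall A, measurable A -> nu A = mu A.

End hard_core.

(* Main.v *)
(* On the bipartite graph Z^2 the hard-core model is attractive: for a vertex [v],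
   the probability that [v] is occupied increases when vertices of the colour of
   [v] are opened and decreases when the others are. So every Gibbs measure lies
   between two extremal boundary conditions outside a box, and it suffices that
   their disagreement at [v] tends to 0 almost surely.

   This is an Imry-Ma / Aizenman-Wehr argument. Let G be the difference of the
   logarithms of the two partition functions in a box of side N. Then |G| is
   O(N), while opening a vertex [v] of the right colour raises G by at least the
   disagreement at [v]. Raise the opening probability from p to p + K/N at N^2
   vertices of one colour, one at a time. If the mean disagreement stayed above
   some eps > 0, each step would raise the mean of G by about (K/N) eps, hence G
   by K N eps in total, which is impossible for K large. The point is that the
   mean disagreement stays above eps/2 along the way: the disagreement in a box
   of fixed radius M is local, and its mean moves by O(M^2 K/N); the difference
   between radius M and radius of order N has small mean under the original
   measure, and the tilted measures have second moment density exp(O(K^2)), so by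
   Cauchy-Schwarz it remains small.

   Decay of the disagreement makes all local finite-volume averages converge. The
   limit extends to a measure, which is Gibbs and with which any Gibbs measure
   agrees on the pi-system of the events [I cap A = 0]. *)

Require Import Defs.
From mathcomp Require Import all_boot all_order all_algebra finmap.
From mathcomp Require Import all_classical all_reals all_analysis measurable_realfun.
From mathcomp Require Import ring lra zify.

Set Implicit Arguments.
Unset Strict Implicit.
Unset Printing Implicit Defensive.

Import Order.TTheory GRing.Theory Num.Theory.
Import numFieldNormedType.Exports.

Local Open Scope ring_scope.

(** * Partition functions and attractiveness *)

Section fpowerset_sums.
Local Open Scope fset_scope.
Local Open Scope ring_scope.
Variables (T : choiceType) (V : nmodType).

Lemma big_fpowersetU1 (u : T) (W : {fset T}) (P : pred {fset T})
    (F : {fset T} -> V) : u \notin W ->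
  \sum_(J <- fpowerset (u |` W) | P J) F J =
  \sum_(J <- fpowerset W | P J) F J + \sum_(J <- fpowerset W | P (u |` J)) F (u |` J).
Proof.
move=> uW.
have -> : fpowerset (u |` W) = fpowerset W `|` [fset u |` J | J in fpowerset W].
  apply/fsetP => J; rewrite !inE !fpowersetE; apply/idP/orP.
    move=> JW; have [uJ|uJ] := boolP (u \in J).
      right; apply/imfsetP; exists (J `\ u); last by rewrite fsetD1K.
      by rewrite /= fpowersetE fsubDset.
    left; apply/fsubsetP => x xJ; move/fsubsetP/(_ x xJ): JW.
    by rewrite !inE => /predU1P[xu|//]; rewrite -xu xJ in uJ.
  case=> [JW|/imfsetP[K /=]]; first exact: fsubset_trans (fsubsetU1 _ _).
  by rewrite fpowersetE => KW ->; apply: fsetUS.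
rewrite [LHS]big_mkcond [X in _ = X + _]big_mkcond [X in _ = _ + X]big_mkcond /=.
rewrite (big_fsetID _ (fun J : {fset T} => u \notin J)) /=; congr (_ + _).
  apply: eq_fbigl => J; rewrite !inE /= fpowersetE.
  have [JW|JW] /= := boolP (J `<=` W).
    apply: contra uW; exact: (fsubsetP JW).
  apply/negbTE/negP => /andP[/imfsetP[K _ ->]].
  by rewrite !inE eqxx.
transitivity (\sum_(J <- [fset u |` J | J in fpowerset W]) (if P J then F J else 0)).
  apply: eq_fbigl => J; rewrite !inE /= negbK.
  apply/andP/imfsetP => [[/orP[]]|[K KW ->]].
  - by rewrite fpowersetE => /fsubsetP JW /JW; rewrite (negbTE uW).
  - by move=> /imfsetP[K KW ->] _; exists K.
  - split; last by rewrite !inE eqxx.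
    by apply/orP; right; apply/imfsetP; exists K.
rewrite big_imfset //= => J K; rewrite !fpowersetE => JW KW /fsetP JK.
apply/fsetP => x; have := JK x; rewrite !inE.
have [->|//] := eqVneq x u.
by rewrite (negbTE (contra (fsubsetP JW u) uW)) (negbTE (contra (fsubsetP KW u) uW)).
Qed.

Lemma big_fpowerset0 (P : pred {fset T}) (F : {fset T} -> V) :
  \sum_(J <- fpowerset fset0 | P J) F J = if P fset0 then F fset0 else 0.
Proof. by rewrite fpowerset0 big_mkcond big_seq_fset1. Qed.

End fpowerset_sums.

Section partition_function.
Local Open Scope fset_scope.
Local Open Scope ring_scope.
Variables (R : realType) (T : choiceType) (e : rel T) (lam : R).
Hypothesis esym : symmetric e.
Hypothesis eirr : irreflexive e.
Hypothesis lam0 : 0 <= lam.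
Implicit Types (S A B F W J X : {fset T}) (u v : T).

Definition indepb J := all (fun u => all (fun v => ~~ e u v) J) J.

Lemma indepbP J :
  reflect (forall u v, u \in J -> v \in J -> ~~ e u v) (indepb J).
Proof.
apply: (iffP allP) => [H u v uJ vJ|H u uJ]; first by have /allP := H u uJ; apply.
by apply/allP => v; apply: H.
Qed.

(** Unnormalised hard-core expectation on the subgraph induced by [S]. Boundary conditions are
    encoded by deleting vertices from [S], so this one sum serves for all of them. *)
Definition hcsum S (g : {fset T} -> R) : R :=
  \sum_(J <- fpowerset S | indepb J) lam ^+ #|` J| * g J.

Definition hcZ S : R := hcsum S (fun=> 1).

Definition nbrs S v := [fset u in S | e v u].

Lemma nbrsE S v u : (u \in nbrs S v) = (u \in S) && e v u.
Proof. by rewrite !inE. Qed.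

Lemma eq_hcsum S g g' : (forall J, J `<=` S -> indepb J -> g J = g' J) ->
  hcsum S g = hcsum S g'.
Proof.
move=> gg'; rewrite /hcsum big_seq_cond [RHS]big_seq_cond.
by apply: eq_bigr => J /andP[]; rewrite fpowersetE => JS iJ; rewrite gg'.
Qed.

Lemma hcsumD S g g' : hcsum S (fun J => g J + g' J) = hcsum S g + hcsum S g'.
Proof. by rewrite /hcsum -big_split; apply: eq_bigr => J _; rewrite mulrDr. Qed.

Lemma hcsumZ S a g : hcsum S (fun J => a * g J) = a * hcsum S g.
Proof. by rewrite /hcsum mulr_sumr; apply: eq_bigr => J _; rewrite mulrCA. Qed.

Lemma hcsum0 g : hcsum fset0 g = g fset0.
Proof. by rewrite /hcsum big_fpowerset0 cardfs0 expr0 mul1r. Qed.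

Lemma indepbU1 v J : v \notin J ->
  indepb (v |` J) = indepb J && all (fun u => ~~ e v u) J.
Proof.
move=> vJ; apply/indepbP/andP => [H|[/indepbP H /allP H']].
  split; first by apply/indepbP => x y xJ yJ; apply: H; rewrite !inE ?xJ ?yJ orbT.
  by apply/allP => x xJ; apply: H; rewrite !inE ?eqxx //; apply/orP; right.
move=> x y; rewrite !inE => /predU1P[->|xJ] /predU1P[->|yJ].
- by rewrite eirr.
- exact: H'.
- by rewrite esym; apply: H'.
- exact: H.
Qed.

(** Split according to the occupation of [v]; if it is occupied, its neighbours are excluded. This
    deletion recursion drives the estimates on partition functions below. *)
Lemma hcsumU1 v S g : v \notin S ->
  hcsum (v |` S) g =
  hcsum S g + lam * hcsum (S `\` nbrs S v) (fun J => g (v |` J)).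
Proof.
move=> vS; rewrite /hcsum big_fpowersetU1 //; congr (_ + _).
rewrite mulr_sumr; apply: eq_fbig_cond => [J|J].
  rewrite !inE /= !fpowersetE; apply/andP/andP => -[].
    move=> JS; rewrite indepbU1 ?(contra (fsubsetP JS v)) // => /andP[iJ /allP eJ].
    split=> //; apply/fsubsetP => u uJ; rewrite !inE (fsubsetP JS) //= andbT.
    exact: eJ.
  move=> /fsubsetP JS iJ; have {}JS u : u \in J -> u \in S /\ ~~ e v u.
    by move=> /JS; rewrite !inE => /andP[+ uS]; rewrite uS.
  have vJ : v \notin J by apply: contra vS => /JS[].
  split; first by apply/fsubsetP => u /JS[].
  by rewrite indepbU1 // iJ; apply/allP => u /JS[].
rewrite fpowersetE => /fsubsetP JS _.
by rewrite cardfsU1 (contra (JS v) vS) add1n exprS mulrA.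
Qed.


Lemma hcZU1 v S : v \notin S -> hcZ (v |` S) = hcZ S + lam * hcZ (S `\` nbrs S v).
Proof. exact: hcsumU1. Qed.

Lemma hcZ0 : hcZ fset0 = 1.
Proof. exact: hcsum0. Qed.

Lemma hcZ_ge0 S : 0 <= hcZ S.
Proof. by apply: sumr_ge0 => J _; rewrite mulr1 exprn_ge0. Qed.

Lemma hcZ_mono A B : A `<=` B -> hcZ A <= hcZ B.
Proof.
move=> /fsetUidPr <-; elim/fset1U_rect: B => [|x B _ IH]; first by rewrite fsetU0.
rewrite fsetUCA; have [xAB|xAB] := boolP (x \in A `|` B).
  by rewrite mem_fset1U.
by rewrite hcZU1 // (le_trans IH) // lerDl mulr_ge0 // hcZ_ge0.
Qed.

Lemma hcZ_gt0 S : 0 < hcZ S.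
Proof. by rewrite (lt_le_trans ltr01) // -hcZ0 hcZ_mono ?fsub0set. Qed.

Lemma hcZU1_le v S : hcZ (v |` S) <= (1 + lam) * hcZ S.
Proof.
have Z0 := hcZ_ge0 S.
have [vS|vS] := boolP (v \in S).
  by rewrite mem_fset1U // mulrDl mul1r lerDl mulr_ge0.
by rewrite hcZU1 // mulrDl mul1r lerD2l ler_wpM2l // hcZ_mono // fsubsetDl.
Qed.

Lemma hcZU_le A B : hcZ (A `|` B) <= (1 + lam) ^+ #|` B| * hcZ A.
Proof.
elim/fset1U_rect: B => [|x B xB IH]; first by rewrite fsetU0 cardfs0 mul1r.
rewrite fsetUCA cardfsU1 xB add1n exprS -mulrA (le_trans (hcZU1_le _ _)) //.
by rewrite ler_wpM2l // addr_ge0.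
Qed.

Lemma hcZU1_isolated b S : b \notin S -> (forall u, u \in S -> ~~ e b u) ->
  hcZ (b |` S) = (1 + lam) * hcZ S.
Proof.
move=> bS Sb; rewrite hcZU1 // mulrDl mul1r; congr (_ + _ * hcZ _).
apply/fsetP => u; rewrite !inE; case: (boolP (u \in S)) => //=.
by move=> /Sb ->.
Qed.

(** The probability that [A] is vacant in the hard-core model on [S]; [hcq] is the case of one
    vertex. Vacancies, unlike occupations, are plain ratios of partition functions. *)
Definition hcr S A : R := hcZ (S `\` A) / hcZ S.
Definition hcq S v : R := hcZ (S `\ v) / hcZ S.

Lemma hcr_gt0 S A : 0 < hcr S A.
Proof. by rewrite divr_gt0 // hcZ_gt0. Qed.

Lemma hcr_le1 S A : hcr S A <= 1.
Proof. by rewrite ler_pdivrMr ?hcZ_gt0 // mul1r hcZ_mono // fsubsetDl. Qed.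

Lemma hcq_gt0 S v : 0 < hcq S v.
Proof. by rewrite divr_gt0 // hcZ_gt0. Qed.

Lemma hcq_le1 S v : hcq S v <= 1.
Proof. by rewrite ler_pdivrMr ?hcZ_gt0 // mul1r hcZ_mono // fsubsetDl. Qed.

Lemma hcq_notin S v : v \notin S -> hcq S v = 1.
Proof. by move=> vS; rewrite /hcq mem_fsetD1 // divff // gt_eqF // hcZ_gt0. Qed.

Lemma hcq_ge S v : 1 <= (1 + lam) * hcq S v.
Proof.
rewrite mulrA ler_pdivlMr ?hcZ_gt0 // mul1r (le_trans _ (hcZU1_le v _)) //.
by rewrite hcZ_mono //; apply/fsubsetP => u; rewrite !inE; case: eqVneq.
Qed.

Lemma hcr0 S : hcr S fset0 = 1.
Proof. by rewrite /hcr fsetD0 divff // gt_eqF // hcZ_gt0. Qed.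

Lemma hcrU1 S a A : hcr S (a |` A) = hcq S a * hcr (S `\ a) A.
Proof.
rewrite /hcr /hcq fsetDDl [RHS]mulrC mulf_div [hcZ (S `\ a) * _]mulrC -mulf_div.
by rewrite divff ?mulr1 // gt_eqF // hcZ_gt0.
Qed.

(** The set [A] need only have the right trace on [S] without [v], so that the same [A] can serve
    two different sets in a comparison. *)
Lemma hcqE S v A : v \in S -> (S `\ v) `&` A = nbrs S v ->
  hcq S v = (1 + lam * hcr (S `\ v) A)^-1.
Proof.
move=> vS SA; rewrite /hcq /hcr -{2}(fsetD1K vS) hcZU1 ?fsetD11 //.
have -> : nbrs (S `\ v) v = nbrs S v.
  by apply/fsetP => u; rewrite !inE; case: eqVneq => [->|]//=; rewrite eirr andbF.
rewrite -SA; have -> : (S `\ v) `\` ((S `\ v) `&` A) = (S `\ v) `\` A.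
  by apply/fsetP => u; rewrite !inE; case: (u \in A); case: (u \in S); case: eqVneq.
have /gt_eqF/negbT x0 := hcZ_gt0 (S `\ v).
rewrite -invf_div; congr (_ ^-1).
by field.
Qed.


(* Conditioning on the occupation of [a]. *)
Lemma hcq_cond S v a A : a != v -> (S `\ a) `&` A = nbrs S a ->
  hcq S v = hcq S a * hcq (S `\ a) v + (1 - hcq S a) * hcq ((S `\ a) `\` A) v.
Proof.
move=> av SA; have [aS|aS] := boolP (a \in S); last first.
  by rewrite (hcq_notin aS) mem_fsetD1 // mul1r subrr mul0r addr0.
have nE S' : a \in S' -> S' `<=` S -> hcZ S' = hcZ (S' `\ a) + lam * hcZ ((S' `\ a) `\` A).
  move=> aS' /fsubsetP S'S; rewrite -{1}(fsetD1K aS') hcZU1 ?fsetD11 //.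
  congr (_ + _ * hcZ _); apply/fsetP => u; rewrite !inE.
  have /fsetP/(_ u) := SA; rewrite !inE.
  have [->|ua] := eqVneq u a; first by rewrite !andbF.
  have [uS'|uS'] /= := boolP (u \in S'); last by rewrite !andbF.
  by rewrite S'S //= !andbT => <-.
have /gt_eqF/negbT Z0 := hcZ_gt0 S.
have /gt_eqF/negbT Z1 := hcZ_gt0 (S `\ a).
have /gt_eqF/negbT Z2 := hcZ_gt0 ((S `\ a) `\` A).
rewrite /hcq (nE (S `\ v)) ?fsubD1set //; last by rewrite !inE av.
have -> : (S `\ v) `\ a = (S `\ a) `\ v by rewrite !fsetDDl fsetUC.
have -> : ((S `\ a) `\ v) `\` A = ((S `\ a) `\` A) `\ v
  by apply/fsetP => u; rewrite !inE; case: (u == v); case: (u \in A).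
have -> : 1 - hcZ (S `\ a) / hcZ S = lam * hcZ ((S `\ a) `\` A) / hcZ S.
  by rewrite -{1}(divff Z0) -mulrBl {1}(nE S) // addrC addKr.
by field; rewrite Z0 Z1 Z2.
Qed.

(** Each added vertex is isolated and contributes a factor [1 + lam] to both partition functions of
    the ratio. *)
Lemma hcq_isolated S B v : v \notin B ->
  (forall b u, b \in B -> u \in S `|` B -> ~~ e b u) -> hcq (S `|` B) v = hcq S v.
Proof.
move=> + SB; elim/fset1U_rect: B SB => [|b B bB IH] SB.
  by rewrite fsetU0.
rewrite !inE negb_or => /andP[vb vB].
rewrite -IH //; last first.
  move=> x u xB; rewrite !inE => uSB; apply: SB; rewrite !inE ?xB ?orbT //.
  by case/orP: uSB => ->; rewrite ?orbT.
rewrite fsetUCA; have [bSB|bSB] := boolP (b \in S `|` B); first by rewrite mem_fset1U.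
have eb u : u \in S `|` B -> ~~ e b u.
  move=> uSB; apply: SB; rewrite !inE ?eqxx //.
  by move: uSB; rewrite !inE => /orP[] ->; rewrite ?orbT.
rewrite /hcq hcZU1_isolated // (_ : (b |` _) `\ v = b |` ((S `|` B) `\ v)); last first.
  by apply/fsetP => u; rewrite !inE; case: (eqVneq u b) => [->|]//=; rewrite eq_sym vb.
rewrite hcZU1_isolated.
- rewrite -mulf_div divff ?mul1r // gt_eqF // ltr_wpDr //.
- by rewrite !inE in bSB *; rewrite negb_and bSB orbT.
- by move=> u; rewrite in_fsetD => /andP[_]; exact: eb.
Qed.

(** * Attractiveness and extremal boundary conditions on a bipartite graph *)

Variable col : T -> bool.
Hypothesis bip : forall u v, e u v -> col u != col v.

(* The order for which the hard-core model on a bipartite graph is attractive: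
   raising [S] adds vertices of colour [c] and deletes vertices of the other
   colour, which favours the occupation of the vertices of colour [c]. *)
Definition hcle (c : bool) S S' :=
  forall u, if col u == c then (u \in S) ==> (u \in S') else (u \in S') ==> (u \in S).

Lemma hcleC c S S' : hcle c S S' -> hcle (~~ c) S' S.
Proof. by move=> H u; have := H u; case: (col u); case: c {H}. Qed.

Lemma hcleD c S S' A : hcle c S S' -> hcle c (S `\` A) (S' `\` A).
Proof. by move=> H u; have := H u; rewrite !inE; case: (u \in A); case: ifP. Qed.

Lemma hcle_monoD c S A : {in A, forall u, col u = c} -> hcle c (S `\` A) S.
Proof.
move=> H u; rewrite !inE; case: ifPn => [_|/eqP uc].
  by apply/implyP => /andP[].
by apply/implyP => ->; rewrite andbT; apply/negP => /H.
Qed.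

(** Induction on the total size. By [hcqE] the vacancy of [v] decreases with the joint vacancy of
    its neighbours once [v] is removed; these have the other colour, for which the order is
    reversed. *)
Lemma hcq_mono c S S' v : hcle c S S' -> col v = c -> hcq S' v <= hcq S v.
Proof.
have [n] := ubnP (#|` S| + #|` S'|)%N; elim: n c S S' v => // n IH c S S' v Sn SS' vc.
have [vS|vS] := boolP (v \in S); last by rewrite (hcq_notin vS) hcq_le1.
have vS' : v \in S' by have := SS' v; rewrite vc eqxx vS.
(* The chain rule [hcrU1] reduces joint vacancies to single ones, to which the induction hypothesis
   applies with the colours exchanged. *)
have rle A X X' : (#|` X| + #|` X'| < n)%N -> hcle c X X' ->
    {in A, forall u, col u = ~~ c} -> hcr X A <= hcr X' A.
  elim/fset1U_rect: A X X' => [|a A aA IHA] X X' Xn XX' Ac; first by rewrite !hcr0.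
  rewrite !hcrU1 ler_pM ?(ltW (hcq_gt0 _ _)) ?(ltW (hcr_gt0 _ _)) //.
    apply: (IH (~~ c)); [by rewrite addnC|exact: hcleC|].
    by apply: Ac; rewrite !inE eqxx.
  apply: IHA; [|exact: hcleD|by move=> u uA; apply: Ac; rewrite !inE uA orbT].
  by rewrite (leq_ltn_trans _ Xn) // leq_add // fsubset_leq_card // fsubD1set.
rewrite (@hcqE S v (nbrs (S `|` S') v)) //; last first.
  apply/fsetP => u; rewrite !inE.
  by case: (eqVneq u v) => [->|]; rewrite ?eirr /= ?andbF //; case: (u \in S).
rewrite (@hcqE S' v (nbrs (S `|` S') v)) //; last first.
  apply/fsetP => u; rewrite !inE.
  by case: (eqVneq u v) => [->|]; rewrite ?eirr /= ?andbF //; case: (u \in S'); rewrite ?orbT.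
have p0 X A : 0 < 1 + lam * hcr X A.
  by rewrite ltr_wpDr // mulr_ge0 // ltW // hcr_gt0.
rewrite lef_pV2 ?posrE // lerD2l ler_wpM2l // rle //.
- move: Sn; rewrite (cardfsD1 v S) (cardfsD1 v S') vS vS' !add1n addnS addSn.
  by rewrite ltnS => /ltnW.
- exact: hcleD.
- by move=> u; rewrite !inE => /andP[_ /bip]; rewrite vc; case: (col u); case: c {IH Sn SS' vc rle}.
Qed.

(** Condition on [a]. Let [w] be its vacancy, [B] and [C] those of [v] given [a] vacant or occupied,
    with primes for [S']. The difference at [v] is [w * (B - B') + (1 - w) * (C - C') + (w' - w) *
    (C' - B')]. The last two terms are nonnegative by monotonicity, and [w] is at least
    [1 / (1 + lam)]. *)
Lemma hcq_removal1 c S S' a v : hcle c S S' -> col v = c -> a != v ->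
  hcq (S `\ a) v - hcq (S' `\ a) v <= (1 + lam) * (hcq S v - hcq S' v).
Proof.
move=> SS' vc av; pose A := nbrs (S `|` S') a.
have SA : (S `\ a) `&` A = nbrs S a.
  apply/fsetP => u; rewrite !inE.
  by case: (eqVneq u a) => [->|]; rewrite ?eirr /= ?andbF //; case: (u \in S).
have S'A : (S' `\ a) `&` A = nbrs S' a.
  apply/fsetP => u; rewrite !inE.
  by case: (eqVneq u a) => [->|]; rewrite ?eirr /= ?andbF //; case: (u \in S'); rewrite ?orbT.
rewrite (hcq_cond av SA) (hcq_cond av S'A).
have Acol u : u \in A -> col u = ~~ col a.
  by rewrite !inE => /andP[_ /bip]; case: (col u); case: (col a).
have h1 : hcq (S' `\ a) v <= hcq (S `\ a) v by apply: hcq_mono vc; exact: hcleD.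
have h2 : hcq ((S' `\ a) `\` A) v <= hcq ((S `\ a) `\` A) v.
  by apply: hcq_mono vc; do 2 apply: hcleD.
have h3 := hcq_ge S a; have h4 := hcq_le1 S a.
(* Whichever colour [a] has, the two factors have the same sign. *)
have h5 : 0 <= (hcq S' a - hcq S a) * (hcq ((S' `\ a) `\` A) v - hcq (S' `\ a) v).
  have [ac|ac] := eqVneq (col a) c.
    apply: mulr_le0; rewrite subr_le0; first exact: (hcq_mono SS').
    apply: (hcq_mono (c := c)) vc.
    rewrite -[c]negbK; apply/hcleC/hcle_monoD => u /Acol ->.
    by rewrite ac.
  have {}ac : col a = ~~ c by case: (col a) c ac {SS' vc} => [] [].
  apply: mulr_ge0; rewrite subr_ge0; first exact: (hcq_mono (hcleC SS')).
  apply: (hcq_mono (c := c)) vc; apply/hcle_monoD => u /Acol ->.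
  by rewrite ac negbK.
have := hcq_gt0 S a.
move: h1 h2 h3 h4 h5; set w := hcq S a; set w' := hcq S' a.
set B := hcq (S `\ a) v; set B' := hcq (S' `\ a) v.
set C := hcq ((S `\ a) `\` A) v; set C' := hcq ((S' `\ a) `\` A) v => h1 h2 h3 h4 h5 h6.
rewrite -subr_ge0; have -> : (1 + lam) * (w * B + (1 - w) * C - (w' * B' + (1 - w') * C')) -
    (B - B')
  = ((1 + lam) * w - 1) * (B - B') + (1 + lam) * ((1 - w) * (C - C') + (w' - w) * (C' - B')).
  by ring.
by rewrite addr_ge0 // mulr_ge0 ?subr_ge0 // addr_ge0 // mulr_ge0 ?subr_ge0.
Qed.

Lemma hcq_removal c S S' F v : hcle c S S' -> col v = c -> v \notin F ->
  hcq (S `\` F) v - hcq (S' `\` F) v <= (1 + lam) ^+ #|` F| * (hcq S v - hcq S' v).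
Proof.
move=> SS' vc; elim/fset1U_rect: F => [|a F aF IH].
  by rewrite !fsetD0 cardfs0 mul1r.
rewrite !inE negb_or => /andP[va vF].
rewrite cardfsU1 aF add1n (fsetUC [fset a]) -!fsetDDl exprS -mulrA
  (le_trans (hcq_removal1 _ vc _)) 1?eq_sym //; first exact: hcleD.
by rewrite ler_wpM2l ?IH // addr_ge0.
Qed.


(** Among the subsets of [W] that contain all of [W] inside [Lam], this is the largest for [hcle c]:
    an extremal boundary condition obtained by deletion. *)
Definition reg (c : bool) (Lam W : {fset T}) :=
  [fset u in W | (col u == c) || (u \in Lam)].

Definition nbd (Lam W : {fset T}) :=
  Lam `<=` W /\ forall u w, u \in Lam -> e u w -> w \in W.

(* The disagreement at [v] between the two extremal boundary conditions
   outside [Lam]; [X] is the set of open vertices. *)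
Definition disc Lam W v X : R :=
  hcq (v |` (reg (~~ col v) Lam W `&` X)) v - hcq (v |` (reg (col v) Lam W `&` X)) v.

Lemma hcle_reg c Lam Lam' W v X : col v = c -> Lam `<=` Lam' ->
  hcle c (v |` (reg c Lam' W `&` X)) (v |` (reg c Lam W `&` X)).
Proof.
move=> vc /fsubsetP LL u; rewrite !inE.
have [_|uc] /= := eqVneq (col u) c; first by rewrite !andbT implybb.
have [uv|_ /=] := eqVneq u v; first by rewrite uv vc eqxx in uc.
by apply/implyP => /andP[/andP[-> /LL ->] ->].
Qed.

Lemma hcle_regC c Lam Lam' W v X : col v = c -> Lam `<=` Lam' ->
  hcle c (v |` (reg (~~ c) Lam W `&` X)) (v |` (reg (~~ c) Lam' W `&` X)).
Proof.
move=> vc /fsubsetP LL u; rewrite !inE.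
have [uc|uc] /= := eqVneq (col u) c.
  rewrite uc; case: eqVneq => //= _; apply/implyP => /andP[/andP[-> /orP[]]].
    by case: (c).
  by move=> /LL -> ->; rewrite orbT.
have -> : (col u == ~~ c) by move: uc; case: (col u); case: (c).
by rewrite !andbT implybb.
Qed.

Lemma disc_ge0 Lam W v X : 0 <= disc Lam W v X.
Proof.
rewrite subr_ge0; apply: (hcq_mono (c := col v)) => // u; rewrite !inE.
have [uv|_ /=] := eqVneq u v; first by rewrite uv eqxx.
case: eqVneq => [->|uc] /=.
  rewrite andbT; apply/implyP => /andP[/andP[-> _] ->] //.
have -> : (col u == ~~ col v) by move: uc; case: (col u); case: (col v).
by apply/implyP => /andP[/andP[-> _] ->].
Qed.

Lemma disc_le1 Lam W v X : disc Lam W v X <= 1.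
Proof. by rewrite lerBlDr (le_trans (hcq_le1 _ _)) // lerDl ltW // hcq_gt0. Qed.

(** The vertices gained from [W'] have colour [c] and no neighbour in [Lam], while outside [Lam]
    only colour [c] is present; so they are isolated. *)
Lemma hcq_reg_ambient c Lam W W' v X : nbd Lam W -> W `<=` W' -> v \in Lam ->
  hcq (v |` (reg c Lam W' `&` X)) v = hcq (v |` (reg c Lam W `&` X)) v.
Proof.
move=> [/fsubsetP LW nW] /fsubsetP WW' vL.
pose B := [fset u in W' | (u \notin W) && (col u == c) && (u \in X)].
have -> : v |` (reg c Lam W' `&` X) = (v |` (reg c Lam W `&` X)) `|` B.
  apply/fsetP => u; rewrite !inE.
  have [->|uv] /= := eqVneq u v => //.
  have [uL|uL] := boolP (u \in Lam).
    by rewrite (LW _ uL) (WW' _ (LW _ uL)) /= ?orbT ?andbF ?orbF.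
  have [uW|uW] /= := boolP (u \in W); first by rewrite WW' //= ?andbF ?orbF.
  by rewrite orbF andbA.
apply: hcq_isolated => [|b u].
  by rewrite !inE (LW _ vL) /= ?andbF.
rewrite !inE => /andP[bW' /andP[/andP[bW /eqP bc] _]].
have xLb x : x \in Lam -> ~~ e b x.
  by move=> xL; apply: contra bW => ebx; apply: (nW x) => //; rewrite esym.
have uc_b : col u = c -> ~~ e b u.
  by move=> uc; apply/negP => /bip; rewrite bc uc eqxx.
move=> /orP[/predU1P[->|/andP[/andP[_ /orP[/eqP|]]]]|].
- exact: xLb.
- by move=> /uc_b.
- by move=> /xLb.
- by move=> /and3P[_ /andP[_ /eqP/uc_b]].
Qed.

Lemma disc_ambient Lam W W' v X : nbd Lam W -> W `<=` W' -> v \in Lam ->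
  disc Lam W' v X = disc Lam W v X.
Proof. by move=> nW WW' vL; congr (_ - _); exact: hcq_reg_ambient. Qed.

(** In a common ambient set, enlarging [Lam] moves the two extremal sets towards each other in the
    order of attractiveness. *)
Lemma disc_mono Lam Lam' W W' v X : nbd Lam W -> nbd Lam' W' -> v \in Lam ->
  Lam `<=` Lam' -> disc Lam' W' v X <= disc Lam W v X.
Proof.
move=> nW nW' vL LL.
have <- := disc_ambient X nW (fsubsetUl W W') vL.
have <- := disc_ambient X nW' (fsubsetUr W W') (fsubsetP LL _ vL).
apply: lerB.
  apply: (hcq_mono (c := col v)) => //; exact: hcle_regC.
apply: (hcq_mono (c := col v)) => //; exact: hcle_reg.
Qed.

Lemma disc_local Lam W v X : disc Lam W v X = disc Lam W v (X `&` W).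
Proof.
have E c : reg c Lam W `&` (X `&` W) = reg c Lam W `&` X.
  by apply/fsetP => u; rewrite !inE; case: (u \in W); rewrite ?andbF ?andbT.
by rewrite /disc !E.
Qed.

(** Sets that agree with [X] on [Lam] and are arbitrary subsets of [X] elsewhere are sandwiched
    between the two extremal sets. So the disagreement controls the influence of everything outside
    [Lam], up to the cost of deleting [F]. *)
Lemma hcq_removal_disc Lam W v X S S' F : nbd Lam W -> v \in Lam ->
  v \in X -> v \notin F -> Lam `&` X `<=` S -> S `<=` X -> Lam `&` X `<=` S' -> S' `<=` X ->
  hcq (S `\` F) v - hcq (S' `\` F) v <= (1 + lam) ^+ #|` F| * disc Lam W v X.
Proof.
move=> nW vL vX vF LS SX LS' S'X; pose U := W `|` X.
rewrite -(disc_ambient X nW (fsubsetUl W X) vL) -/U.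
set E := v |` (reg (col v) Lam U `&` X); set O := v |` (reg (~~ col v) Lam U `&` X).
have SE S0 : Lam `&` X `<=` S0 -> S0 `<=` X -> hcle (col v) S0 E.
  move=> /fsubsetP L0 /fsubsetP X0 u; rewrite !inE; case: ifPn => [/eqP uv|uv].
    by apply/implyP => uS0; rewrite (X0 _ uS0) ?uv ?eqxx /= ?orbT.
  apply/implyP => /predU1P[uv'|]; first by rewrite uv' eqxx in uv.
  by rewrite (negbTE uv) /= => /andP[/andP[_ uL] uX]; apply: L0; rewrite inE uL uX.
have OS S0 : Lam `&` X `<=` S0 -> S0 `<=` X -> hcle (col v) O S0.
  move=> /fsubsetP L0 /fsubsetP X0 u; rewrite !inE; case: ifPn => [/eqP uv|uv].
    apply/implyP => /predU1P[->|]; first by apply: L0; rewrite inE vL vX.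
    rewrite uv (_ : (col v == ~~ col v) = false) /=; last by case: (col v).
    by move=> /andP[/andP[_ uL] uX]; apply: L0; rewrite inE uL uX.
  have -> : (col u == ~~ col v) by move: uv; case: (col u); case: (col v).
  by apply/implyP => uS0; rewrite (X0 _ uS0) ?uv ?eqxx /= ?orbT.
have EO : hcle (col v) O E.
  move=> u; have := OS _ LS SX u; have := SE _ LS SX u.
  by case: ifP => _ /implyP h1 /implyP h2; apply/implyP => /[dup] ? ; [move=> /h2/h1|move=> /h1/h2].
apply: le_trans (hcq_removal EO erefl vF); rewrite lerB //.
  by apply: (hcq_mono (c := col v)) => //; apply: hcleD; apply: OS.
by apply: (hcq_mono (c := col v)) => //; apply: hcleD; apply: SE.
Qed.

End partition_function.

(** * Product Bernoulli measures on a finite set *)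

Section bernoulli_expectation.
Local Open Scope fset_scope.
Local Open Scope ring_scope.
Variables (R : realType) (T : choiceType).
Implicit Types (pi : T -> R) (W S : {fset T}) (f g : {fset T} -> R) (u v : T).

(* Expectation of [f] of the set of open vertices of [W], when the vertices are
   open independently, [u] with probability [pi u]. *)
Definition bexp pi W f : R :=
  \sum_(S <- fpowerset W) (\prod_(u <- W) (if u \in S then pi u else 1 - pi u)) * f S.

Lemma bexp0 pi f : bexp pi fset0 f = f fset0.
Proof. by rewrite /bexp big_fpowerset0 big_seq_fset0 mul1r. Qed.

Lemma bexpU1 pi u W f : u \notin W -> bexp pi (u |` W) f =
  pi u * bexp pi W (fun S => f (u |` S)) + (1 - pi u) * bexp pi W f.
Proof.
move=> uW; rewrite /bexp big_fpowersetU1 // addrC !mulr_sumr.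
congr (_ + _); rewrite big_seq [RHS]big_seq; apply: eq_bigr => S;
    rewrite fpowersetE => /fsubsetP SW; rewrite big_fsetU1 // mulrA.
  rewrite !inE eqxx /=; congr (_ * _ * _); rewrite big_seq [RHS]big_seq.
  apply: eq_bigr => w wW; rewrite !inE.
  by have [wu|//] := eqVneq w u; rewrite wu (negbTE uW) in wW.
by rewrite (negbTE (contra (SW u) uW)).
Qed.

Lemma eq_bexp pi pi' W f g : {in W, pi =1 pi'} ->
  (forall S, S `<=` W -> f S = g S) -> bexp pi W f = bexp pi' W g.
Proof.
move=> pp fg; rewrite /bexp big_seq [RHS]big_seq; apply: eq_bigr => S.
rewrite fpowersetE => SW; rewrite fg //; congr (_ * _).
by rewrite big_seq [RHS]big_seq; apply: eq_bigr => u uW; rewrite pp.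
Qed.

Lemma bexpD pi W f g : bexp pi W (fun S => f S + g S) = bexp pi W f + bexp pi W g.
Proof. by rewrite /bexp -big_split; apply: eq_bigr => S _; rewrite mulrDr. Qed.

Lemma bexpZ pi W a f : bexp pi W (fun S => a * f S) = a * bexp pi W f.
Proof. by rewrite /bexp mulr_sumr; apply: eq_bigr => S _; rewrite mulrCA. Qed.

Lemma bexpB pi W f g : bexp pi W (fun S => f S - g S) = bexp pi W f - bexp pi W g.
Proof.
rewrite -[X in _ - X]mul1r -mulNr -bexpZ -bexpD.
by apply: eq_bexp => // S _; rewrite mulN1r.
Qed.

Lemma bexp_cst pi W c : bexp pi W (fun=> c) = c.
Proof.
elim/fset1U_rect: W => [|u W uW IH]; first exact: bexp0.
by rewrite bexpU1 // IH; ring.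
Qed.

Lemma ler_bexp pi W f g : (forall u, 0 <= pi u <= 1) ->
  (forall S, S `<=` W -> f S <= g S) -> bexp pi W f <= bexp pi W g.
Proof.
move=> pi01 fg; rewrite /bexp big_seq [leRHS]big_seq; apply: ler_sum => S.
rewrite fpowersetE => SW; apply: ler_wpM2l (fg _ SW); apply: prodr_ge0 => u _.
by have /andP[p0 p1] := pi01 u; case: ifP; rewrite ?subr_ge0.
Qed.

(** The expectation is affine in [pi v], so Russo's formula is exact for a finite change at one
    vertex. *)
Lemma bexp_site pi pi' W v f : v \in W -> (forall u, u != v -> pi' u = pi u) ->
  bexp pi' W f - bexp pi W f =
  (pi' v - pi v) * bexp pi W (fun S => f (v |` S) - f (S `\ v)).
Proof.
move=> vW pp; rewrite -(fsetD1K vW) !bexpU1 ?fsetD11 //.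
have Ep g : bexp pi' (W `\ v) g = bexp pi (W `\ v) g.
  by apply: eq_bexp => // u; rewrite !inE => /andP[/pp].
have vS S : S `<=` W `\ v -> v \notin S.
  by move=> /fsubsetP SW; apply/negP => /SW; rewrite fsetD11.
have E2 : bexp pi (W `\ v) (fun S => f (v |` (v |` S)) - f ((v |` S) `\ v)) =
  bexp pi (W `\ v) (fun S => f (v |` S) - f S).
  by apply: eq_bexp => // S /vS vS'; rewrite fsetU1K // fsetUA fsetUid.
have E3 : bexp pi (W `\ v) (fun S => f (v |` S) - f (S `\ v)) =
  bexp pi (W `\ v) (fun S => f (v |` S) - f S).
  by apply: eq_bexp => // S /vS vS'; rewrite mem_fsetD1.
by rewrite !Ep E2 E3 bexpB; ring.
Qed.

Lemma bexp_local pi W W0 f : W0 `<=` W -> (forall S, f S = f (S `&` W0)) ->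
  bexp pi W f = bexp pi W0 f.
Proof.
move=> /fsetUidPr <- fl; elim/fset1U_rect: W => [|u W uW IH].
  by rewrite fsetU0.
rewrite fsetUCA; have [uW0|uW0] := boolP (u \in W0 `|` W).
  by rewrite mem_fset1U.
rewrite bexpU1 // IH (_ : bexp _ _ (fun=> _) = bexp pi W0 f); last first.
  rewrite -IH; apply: eq_bexp => // S _; rewrite fl [RHS]fl; congr f.
  apply/fsetP => x; rewrite !inE; case: (eqVneq x u) => [->|//].
  by move: uW0; rewrite !inE negb_or => /andP[/negbTE -> _]; rewrite !andbF.
ring.
Qed.

(** Subadditivity of the total variation distance over the factors of a product, one vertex at a
    time. *)
Lemma bexp_tv pi pi' W f : (forall u, 0 <= pi u <= 1) -> (forall u, 0 <= pi' u <= 1) ->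
  (forall S, 0 <= f S <= 1) ->
  bexp pi' W f - bexp pi W f <= \sum_(u <- W) `|pi u - pi' u|.
Proof.
move=> p01 p01'; elim/fset1U_rect: W f => [|u W uW IH] f f01.
  by rewrite !bexp0 big_seq_fset0 subrr.
rewrite !bexpU1 // big_fsetU1 //=.
have hA := IH (fun S => f (u |` S)) (fun S => f01 _).
have hB := IH f f01.
set s := \sum_(_ <- _) _ in hA hB *.
set A := bexp pi W _ in hA *; set B := bexp pi W _ in hB *.
set A' := bexp pi' W _ in hA *; set B' := bexp pi' W _ in hB *.
have /andP[a0 a1] := p01 u.
have bnd g : (forall S, 0 <= g S <= 1) -> 0 <= bexp pi' W g <= 1.
  move=> g01; rewrite -{1}(bexp_cst pi' W 0) -(bexp_cst pi' W 1).
  by rewrite !ler_bexp // => S _; case/andP: (g01 S).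
have /andP[A0 A1] : 0 <= A' <= 1 by apply: bnd.
have /andP[B0 B1] : 0 <= B' <= 1 by apply: bnd.
have -> : pi' u * A' + (1 - pi' u) * B' - (pi u * A + (1 - pi u) * B) =
  (pi u * (A' - A) + (1 - pi u) * (B' - B)) + (pi' u - pi u) * (A' - B') by ring.
rewrite [leLHS]addrC; apply: lerD.
  rewrite distrC (le_trans (ler_norm _)) // normrM ler_piMr // ler_norml.
  by rewrite !lerBlDr lerBrDr; apply/andP; split; lra.
have -> : s = pi u * s + (1 - pi u) * s by ring.
by rewrite lerD // ler_wpM2l // subr_ge0.
Qed.

(** The second moment of the density is the product of the factors
    [1 + (pi u - p) ^+ 2 / (p * (1 - p))], each bounded by an exponential. Induction on the vertices
    reduces everything to Cauchy-Schwarz on two points. *)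
Lemma bexp_cauchy_schwarz pi p W f : (forall u, 0 <= pi u <= 1) -> 0 < p < 1 ->
  bexp pi W f ^+ 2 <= expR (\sum_(u <- W) (pi u - p) ^+ 2 / (p * (1 - p))) *
    bexp (fun=> p) W (fun S => f S ^+ 2).
Proof.
move=> p01 /andP[p0 p1]; elim/fset1U_rect: W f => [|u W uW IH] f.
  by rewrite !bexp0 big_seq_fset0 expR0 mul1r.
rewrite !bexpU1 // big_fsetU1 //= expRD.
have hA := IH (fun S => f (u |` S)); have hB := IH f.
set A := bexp pi W _ in hA *; set B := bexp pi W _ in hB *.
set A2 := bexp _ W _ in hA *; set B2 := bexp _ W _ in hB *.
set E := expR _ in hA hB *; set a := pi u; set x := (a - p) ^+ 2 / _.
have q0 : 0 < 1 - p by rewrite subr_gt0.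
have pq0 : 0 <= p * (1 - p) by rewrite mulr_ge0 // ltW.
have hx := expR_ge1Dx x.
have xE : 1 + x = a ^+ 2 / p + (1 - a) ^+ 2 / (1 - p).
  by rewrite /x; field; rewrite !gt_eqF.
have x0 : 0 <= x by rewrite divr_ge0 ?sqr_ge0.
have h1 : (a * A + (1 - a) * B) ^+ 2 <= (1 + x) * (p * A ^+ 2 + (1 - p) * B ^+ 2).
  rewrite xE -subr_ge0.
  (* Lagrange's identity: the defect in Cauchy-Schwarz is a multiple of a square. *)
  have -> : (a ^+ 2 / p + (1 - a) ^+ 2 / (1 - p)) * (p * A ^+ 2 + (1 - p) * B ^+ 2) -
     (a * A + (1 - a) * B) ^+ 2 =
     (a * (1 - p) * B - (1 - a) * p * A) ^+ 2 / (p * (1 - p)).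
    by field; rewrite !gt_eqF.
  by rewrite divr_ge0 ?sqr_ge0.
apply: le_trans h1 _; rewrite -mulrA; apply: ler_pM => //.
- by rewrite addr_ge0.
- by rewrite addr_ge0 // mulr_ge0 ?sqr_ge0 ?(ltW p0) ?(ltW q0).
rewrite mulrDr !(mulrCA E); apply: lerD; apply: ler_wpM2l => //; exact: ltW.
Qed.

Lemma bexp_imfset pi W (h : T -> T) f : injective h -> (forall u, pi (h u) = pi u) ->
  bexp pi (h @` W) f = bexp pi W (fun S => f (h @` S)).
Proof.
move=> hI ph; elim/fset1U_rect: W f => [|u W uW IH] f.
  by rewrite imfset0 !bexp0 imfset0.
rewrite imfsetU1 !bexpU1 //; last by rewrite mem_imfset.
rewrite !IH ph; congr (_ * _ + _).
by apply: eq_bexp => // S _; rewrite imfsetU1.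
Qed.

End bernoulli_expectation.

(** * Invariance of partition functions under graph embeddings *)

Section hc_imfset.
Local Open Scope fset_scope.
Local Open Scope ring_scope.
Variables (R : realType) (T T' : choiceType) (e : rel T) (e' : rel T') (lam : R).
Variable h : T -> T'.
Implicit Types (S A : {fset T}) (v : T).
Hypotheses (esym : symmetric e) (eirr : irreflexive e).
Hypotheses (esym' : symmetric e') (eirr' : irreflexive e').
Hypotheses (hI : injective h) (he : forall u v, e' (h u) (h v) = e u v).

Lemma imfsetD_inj (A B : {fset T}) : h @` (A `\` B) = h @` A `\` h @` B.
Proof.
apply/fsetP => x; rewrite inE; apply/imfsetP/andP => /=.
  move=> [y]; rewrite inE => /andP[yB yA] ->.
  by rewrite !mem_imfset //.
by move=> [xB /imfsetP[y /= yA xy]]; exists y => //;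
  rewrite inE yA andbT; rewrite xy mem_imfset in xB.
Qed.

Lemma nbrs_imfset S v : nbrs e' (h @` S) (h v) = h @` nbrs e S v.
Proof.
apply/fsetP => x; rewrite !inE; apply/andP/imfsetP => /=.
  by move=> [/imfsetP[y /= yS ->]]; rewrite he => evy; exists y; rewrite ?inE ?yS.
by move=> [y]; rewrite !inE => /andP[yS evy] ->; rewrite he evy mem_imfset.
Qed.

(** This serves both for the translations of the lattice and for the embedding of the percolation
    graph into it. *)
Lemma hcZ_imfset S : hcZ e' lam (h @` S) = hcZ e lam S.
Proof.
have [n] := ubnP #|` S|; elim: n S => // n IH S Sn.
have [->|/fset0Pn [v vS]] := eqVneq S fset0; first by rewrite imfset0 !hcZ0.
have Sn' : (#|` S `\ v| < n)%N by move: Sn; rewrite (cardfsD1 v) vS.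
have hvS : h v \notin h @` (S `\ v).
  by apply/imfsetP => -[w /= wS /hI vw]; rewrite -vw fsetD11 in wS.
rewrite -(fsetD1K vS) imfsetU1 !hcZU1 ?fsetD11 //.
rewrite IH // nbrs_imfset -imfsetD_inj IH //.
by rewrite (leq_ltn_trans _ Sn') // fsubset_leq_card // fsubsetDl.
Qed.

Lemma hcq_imfset S v : hcq e' lam (h @` S) (h v) = hcq e lam S v.
Proof. by rewrite /hcq -imfset_fset1 -imfsetD_inj !hcZ_imfset. Qed.

End hc_imfset.

(** * The free-energy difference between the two boundary conditions *)

Section free_energy.
Local Open Scope fset_scope.
Local Open Scope ring_scope.
Variables (R : realType) (T : choiceType) (e : rel T) (lam : R) (col : T -> bool).
Hypothesis esym : symmetric e.
Hypothesis eirr : irreflexive e.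
Hypothesis lam0 : 0 <= lam.
Hypothesis bip : forall u v, e u v -> col u != col v.
Implicit Types (S Lam W U Q : {fset T}) (u v : T).

Local Notation Z := (hcZ e lam).
Local Notation dis := (disc e lam col).

(** The logarithm has slope at least 1 up to 1. This turns differences of vacancies into differences
    of free energies. *)
Lemma ler_subln (a b : R) : 0 < a -> a <= b -> b <= 1 -> b - a <= ln b - ln a.
Proof.
move=> a0 ab b1; have b0 := lt_le_trans a0 ab.
rewrite -[leRHS]opprB -ln_div ?posrE // lerNr opprB.
have -> : a / b = 1 + (a / b - 1) by ring.
apply: le_trans (le_ln1Dx _) _; first by rewrite ltrBrDr addNr divr_gt0.
have -> : a / b - 1 = - ((b - a) / b) by field; rewrite gt_eqF.
by rewrite lerNl opprB ler_pdivlMr // ler_piMr // subr_ge0.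
Qed.

(** The quantity G of the overview. *)
Definition fe (c : bool) Lam W S : R :=
  ln (Z (reg col c Lam W `&` S)) - ln (Z (reg col (~~ c) Lam W `&` S)).

(** Both partition functions are at least that of the part of [S] in [Lam], and exceed it by at most
    a factor [1 + lam] for each vertex of [W] outside [Lam]. *)
Lemma fe_bound c Lam W S : Lam `<=` W ->
  `|fe c Lam W S| <= #|` W `\` Lam|%:R * ln (1 + lam).
Proof.
move=> LW; have ln0 : 0 <= ln (1 + lam) by rewrite ln_ge0 // lerDl.
have L1 : 0 < 1 + lam by rewrite ltr_wpDr.
have lo b : ln (Z (Lam `&` S)) <= ln (Z (reg col b Lam W `&` S)).
  rewrite ler_ln ?posrE ?hcZ_gt0 // hcZ_mono //; apply/fsubsetP => u.
  by rewrite !inE => /andP[uL ->]; rewrite uL (fsubsetP LW _ uL) orbT.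
have hi b : ln (Z (reg col b Lam W `&` S)) <=
    ln (Z (Lam `&` S)) + #|` W `\` Lam|%:R * ln (1 + lam).
  rewrite mulr_natl -lnXn // -lnM ?posrE ?hcZ_gt0 ?exprn_gt0 //.
  rewrite ler_ln ?posrE ?mulr_gt0 ?hcZ_gt0 ?exprn_gt0 // mulrC.
  apply: le_trans (hcZU_le _ _ _ _ _) => //; rewrite hcZ_mono //.
  apply/fsubsetP => u; rewrite !inE => /andP[/andP[-> _] ->].
  by case: (u \in Lam).
rewrite /fe ler_norml; have := lo c; have := hi c; have := lo (~~ c); have := hi (~~ c).
by move=> *; apply/andP; split; lra.
Qed.

(** Opening [v] changes the logarithm of a partition function by minus the logarithm of the vacancy
    of [v]; [ler_subln] then compares with the vacancies themselves. *)
Lemma fe_flip Lam W v S : Lam `<=` W -> v \in Lam ->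
  dis Lam W v S <= fe (col v) Lam W (v |` S) - fe (col v) Lam W (S `\ v).
Proof.
move=> /fsubsetP LW vL.
have E1 b : reg col b Lam W `&` (v |` S) = v |` (reg col b Lam W `&` S).
  by apply/fsetP => u; rewrite !inE; case: (eqVneq u v) => [->|//]; rewrite vL LW // orbT.
have E2 b : reg col b Lam W `&` (S `\ v) = (v |` (reg col b Lam W `&` S)) `\ v.
  by apply/fsetP => u; rewrite !inE; case: (eqVneq u v) => [->|//]; rewrite ?andbF.
have lnq X : ln (Z (X `\ v)) - ln (Z X) = ln (hcq e lam X v).
  by rewrite -ln_div ?posrE ?hcZ_gt0.
rewrite /fe !E1 !E2.
set X := v |` _; set Y := v |` _.
have -> : ln (Z X) - ln (Z Y) - (ln (Z (X `\ v)) - ln (Z (Y `\ v))) =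
  (ln (Z (Y `\ v)) - ln (Z Y)) - (ln (Z (X `\ v)) - ln (Z X)) by ring.
rewrite !lnq; apply: ler_subln; [exact: hcq_gt0| |exact: hcq_le1].
by rewrite -subr_ge0; exact: disc_ge0.
Qed.

Definition tilt Q (p h : R) u := if u \in Q then p + h else p.

Lemma tilt01 Q p h u : 0 <= p -> 0 <= h -> p + h <= 1 -> 0 <= tilt Q p h u <= 1.
Proof. by move=> *; rewrite /tilt; case: ifP => _; apply/andP; split; lra. Qed.

(** The vertices of [Q] are tilted one at a time, each gaining at least [h * b] by [bexp_site] and
    [fe_flip]; hence the lower bound is asked for all intermediate [Q']. The factor 2 comes from
    bounding the free energy at both ends. *)
Lemma tilt_gain c Lam W U Q (p h b : R) : Lam `<=` W -> Q `<=` Lam -> Q `<=` U ->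
  {in Q, forall v, col v = c} -> 0 <= p -> 0 <= h -> p + h <= 1 ->
  (forall Q' v, Q' `<=` Q -> v \in Q -> b <= bexp (tilt Q' p h) U (dis Lam W v)) ->
  h * #|` Q|%:R * b <= 2 * (#|` W `\` Lam|%:R * ln (1 + lam)).
Proof.
move=> LW QL QU Qc p0 h0 ph1 Hb.
pose F Q' := bexp (tilt Q' p h) U (fe c Lam W).
have gain Q' : Q' `<=` Q -> h * #|` Q'|%:R * b <= F Q' - F fset0.
  elim/fset1U_rect: Q' => [_|v Q' vQ' IH].
    by rewrite cardfs0 mulr0 mul0r subrr.
  move=> /fsubsetP vQQ; have Q'Q : Q' `<=` Q.
    by apply/fsubsetP => u uQ'; apply: vQQ; rewrite !inE uQ' orbT.
  have vQ : v \in Q by apply: vQQ; rewrite !inE eqxx.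
  have /IH {}IH := Q'Q.
  have step : h * b <= F (v |` Q') - F Q'.
    rewrite /F (@bexp_site _ _ (tilt Q' p h) _ _ v) ?(fsubsetP QU) //; last first.
      by move=> u /negbTE uv; rewrite /tilt !inE uv.
    rewrite /tilt !inE eqxx (negbTE vQ') addrAC subrr add0r ler_wpM2l //.
    apply: le_trans (Hb _ _ Q'Q vQ) _; apply: ler_bexp => [u|S _].
      exact: tilt01.
    by rewrite -(Qc _ vQ); apply: fe_flip => //; apply: (fsubsetP QL).
  rewrite cardfsU1 vQ' natrD mulrDr mulr1 mulrDl.
  by have -> : F (v |` Q') - F fset0 = (F (v |` Q') - F Q') + (F Q' - F fset0); [ring|rewrite lerD].
apply: le_trans (gain _ (fsubset_refl Q)) _.
have bnd Q' : `|F Q'| <= #|` W `\` Lam|%:R * ln (1 + lam).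
  have t01 u := @tilt01 Q' p h u p0 h0 ph1.
  rewrite ler_norml -[X in X <= _ <= _](bexp_cst (tilt Q' p h) U).
  rewrite -[X in _ <= _ <= X](bexp_cst (tilt Q' p h) U).
  rewrite !ler_bexp // => S _; have := fe_bound c S LW; rewrite ler_norml => /andP[] //.
have := bnd Q; have := bnd fset0; rewrite !ler_norml => /andP[h1 h2] /andP[h3 h4].
lra.
Qed.

(** The disagreement for [Lam] is at least that for [Lam1], which is the one for [Lam0] minus [D].
    Passing from [p] to [pi] costs a total variation term on [W0] for the former and is handled by
    Cauchy-Schwarz for [D]. *)
Lemma bexp_disc_ge Lam W Lam0 W0 Lam1 W1 U v pi (p k : R) :
  nbd e Lam W -> nbd e Lam0 W0 -> nbd e Lam1 W1 -> v \in Lam0 -> v \in Lam ->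
  Lam0 `<=` Lam1 -> Lam `<=` Lam1 -> W0 `<=` U -> W1 `<=` U ->
  (forall u, 0 <= pi u <= 1) -> 0 < p < 1 ->
  \sum_(u <- U) (pi u - p) ^+ 2 / (p * (1 - p)) <= k ->
  bexp (fun=> p) W0 (dis Lam0 W0 v) - \sum_(u <- W0) `|pi u - p| -
    Num.sqrt (expR k * (bexp (fun=> p) W0 (dis Lam0 W0 v) - bexp (fun=> p) W1 (dis Lam1 W1 v)))
  <= bexp pi U (dis Lam W v).
Proof.
move=> nW nW0 nW1 vL0 vL LL LL1 WU0 WU1 p01 pp Hk.
have p01' u : 0 <= p <= 1 by case/andP: pp => *; rewrite !ltW.
have loc0 := @bexp_local _ _ _ U W0 (dis Lam0 W0 v) WU0 (disc_local _ _ _ _ _ _).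
have loc1 := @bexp_local _ _ _ U W1 (dis Lam1 W1 v) WU1 (disc_local _ _ _ _ _ _).
have h1 : bexp pi U (dis Lam1 W1 v) <= bexp pi U (dis Lam W v).
  by apply: ler_bexp => // S _; exact: disc_mono.
have h2 : bexp (fun=> p) W0 (dis Lam0 W0 v) - \sum_(u <- W0) `|pi u - p|
    <= bexp pi U (dis Lam0 W0 v).
  rewrite loc0 lerBlDr -lerBlDl; apply: bexp_tv => // S.
  by rewrite disc_ge0 // disc_le1.
pose D S := dis Lam0 W0 v S - dis Lam1 W1 v S.
have D0 S : 0 <= D S by rewrite subr_ge0; exact: disc_mono.
have D1 S : D S <= 1.
  have h : dis Lam0 W0 v S <= 1 by exact: disc_le1.
  have h' : 0 <= dis Lam1 W1 v S by exact: disc_ge0.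
  by rewrite lerBlDr (le_trans h) // lerDl.
have h3 : bexp pi U D <= Num.sqrt (expR k *
    (bexp (fun=> p) W0 (dis Lam0 W0 v) - bexp (fun=> p) W1 (dis Lam1 W1 v))).
  have B0 : 0 <= bexp pi U D by rewrite -[leLHS](bexp_cst pi U) ler_bexp.
  rewrite -[leLHS](ger0_norm B0) -sqrtr_sqr ler_sqrt; last first.
    rewrite mulr_ge0 ?expR_ge0 // -loc0 -loc1 -bexpB -[leLHS](bexp_cst (fun=> p) U).
    by apply: ler_bexp => // S _; exact: D0.
  apply: le_trans (bexp_cauchy_schwarz _ _ p01 pp) _.
  apply: ler_pM; rewrite ?expR_ge0 ?ler_expR //.
    by rewrite -[leLHS](bexp_cst (fun=> p) U) ler_bexp // => S _; rewrite sqr_ge0.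
  (* As [D] has values in [[0, 1]], its second moment is at most its mean. *)
  rewrite -loc0 -loc1 -bexpB; apply: ler_bexp => // S _.
  by rewrite expr2 ler_piMl.
have BD : bexp pi U D = bexp pi U (dis Lam0 W0 v) - bexp pi U (dis Lam1 W1 v) by exact: bexpB.
apply: le_trans h1; rewrite lerBlDr (le_trans h2) // -lerBlDl -BD.
exact: h3.
Qed.

End free_energy.

(** * The square lattice *)

Section square_lattice.
Local Open Scope fset_scope.
Local Open Scope ring_scope.
Implicit Types (a u v : int * int) (n r : nat) (X : {fset int * int}).

Definition parity u : bool := (2 %| u.1 + u.2)%Z.

Lemma Z2adj_sym : symmetric Z2adj.
Proof. by move=> u v; rewrite /Z2adj distrC [X in _ + X]distrC. Qed.

Lemma Z2adj_parity u v : Z2adj u v -> parity u != parity v.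
Proof. rewrite /Z2adj /parity; case: u => a b; case: v => c d /=; lia. Qed.

Lemma Z2adj_irr : irreflexive Z2adj.
Proof. by move=> u; apply/negP => /Z2adj_parity; rewrite eqxx. Qed.

Definition sq a n : {fset int * int} :=
  [fset (a.1 + (val x.1)%:Z, a.2 + (val x.2)%:Z) | x : 'I_n * 'I_n].

Lemma mem_sq a n u : (u \in sq a n) =
  [&& a.1 <= u.1, u.1 < a.1 + n%:Z, a.2 <= u.2 & u.2 < a.2 + n%:Z].
Proof.
apply/imfsetP/and4P => /= [[[[i Hi] [j Hj]] _ ->] /=|[h1 h2 h3 h4]].
  by split; lia.
have Hi : (`|u.1 - a.1| < n)%N by lia.
have Hj : (`|u.2 - a.2| < n)%N by lia.
exists (Ordinal Hi, Ordinal Hj) => //=.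
by case: u {Hi Hj} h1 h2 h3 h4 => x y /= *; congr (_, _); lia.
Qed.

Lemma card_sq a n : #|` sq a n| = (n * n)%N.
Proof.
rewrite card_imfset /=; first by rewrite -cardE card_prod card_ord.
move=> [i j] [i' j'] /= [] /addrI [ii] /addrI [jj].
by congr (_, _); apply: val_inj.
Qed.

Definition box v r := sq (v.1 - r%:Z, v.2 - r%:Z) (2 * r).+1.

Lemma mem_box v r u : (u \in box v r) =
  [&& v.1 - r%:Z <= u.1, u.1 <= v.1 + r%:Z, v.2 - r%:Z <= u.2 & u.2 <= v.2 + r%:Z].
Proof. by rewrite mem_sq /=; lia. Qed.

Lemma box_center v r : v \in box v r.
Proof. by rewrite mem_box; lia. Qed.

Lemma box_subset v r r' : (r <= r')%N -> box v r `<=` box v r'.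
Proof. by move=> rr; apply/fsubsetP => u; rewrite !mem_box; lia. Qed.

Lemma nbd_sq a n : nbd Z2adj (sq a n) (sq (a.1 - 1, a.2 - 1) n.+2).
Proof.
split; first by apply/fsubsetP => u; rewrite !mem_sq /=; lia.
by move=> u w; rewrite !mem_sq /Z2adj /=; lia.
Qed.

Lemma nbd_box v r : nbd Z2adj (box v r) (box v r.+1).
Proof.
split; first exact: box_subset.
by move=> u w; rewrite !mem_box /Z2adj /=; lia.
Qed.

Definition shift v u : int * int := (u.1 + v.1, u.2 + v.2).

Lemma shift_inj v : injective (shift v).
Proof. by move=> [a b] [c d] [] /addIr -> /addIr ->. Qed.

Lemma shift_box v r : shift v @` box (0, 0) r = box v r.
Proof.
apply/fsetP => u; apply/imfsetP/idP => /= [[w + ->]|].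
  by rewrite !mem_box /=; lia.
rewrite mem_box => ub; exists (u.1 - v.1, u.2 - v.2).
  by rewrite mem_box /=; lia.
by rewrite /shift /= !subrK; case: (u).
Qed.

(** Half of the even vertices of the square are enough, as only a positive density matters, and
    these are immediate to count. *)
Definition even_pts N : {fset int * int} :=
  [fset ((2 * val x.1)%N%:Z, (2 * val x.2)%N%:Z) | x : 'I_N * 'I_N].

Lemma even_ptsP N u : u \in even_pts N ->
  [/\ parity u, 0 <= u.1 < (2 * N)%N%:Z & 0 <= u.2 < (2 * N)%N%:Z].
Proof.
move=> /imfsetP[/= [[i Hi] [j Hj]] _ ->] /=.
by rewrite /parity /=; split; lia.
Qed.

Lemma card_even_pts N : #|` even_pts N| = (N * N)%N.
Proof.
rewrite card_imfset /=; first by rewrite -cardE card_prod card_ord.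
move=> [[i Hi] [j Hj]] [[i' Hi'] [j' Hj']] /= [h1 h2].
by congr (_, _); apply: val_inj => /=; lia.
Qed.

Lemma even_pts_sq N : even_pts N `<=` sq (0, 0) (2 * N).
Proof. by apply/fsubsetP => u /even_ptsP[_ ? ?]; rewrite mem_sq /=; lia. Qed.

Lemma sq_sub_box0 N r : (2 * N <= r)%N -> sq (0, 0) (2 * N) `<=` box (0, 0) r.
Proof. by move=> ?; apply/fsubsetP => u; rewrite mem_sq mem_box /=; lia. Qed.

Lemma sq_sub_box N M v : v \in sq (0, 0) (2 * N) ->
  sq (0, 0) (2 * N) `<=` box v (2 * N + M).
Proof.
by rewrite mem_sq /= => ?; apply/fsubsetP => u; rewrite mem_sq mem_box /=; lia.
Qed.

Lemma box_sub_box0 N r r' v : v \in sq (0, 0) (2 * N) -> (2 * N + r <= r')%N ->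
  box v r `<=` box (0, 0) r'.
Proof.
by rewrite mem_sq /= => ? ?; apply/fsubsetP => u; rewrite !mem_box /=; lia.
Qed.

Lemma card_annulus N : #|` sq (0 - 1, 0 - 1) (2 * N).+2 `\` sq (0, 0) (2 * N)| = (8 * N + 4)%N.
Proof. by rewrite cardfsDS ?(nbd_sq (0, 0) _).1 // !card_sq; lia. Qed.

End square_lattice.

(** * The Imry-Ma argument: the mean disagreement becomes small *)

Section imry_ma.
Local Open Scope fset_scope.
Local Open Scope ring_scope.
Variables (R : realType) (lam : R).
Hypothesis lam0 : 0 <= lam.
Implicit Types (a u v : int * int) (n r : nat) (X : {fset int * int}).

Definition dsc r v X : R := disc Z2adj lam parity (box v r) (box v r.+1) v X.

Definition mean_dsc (p : R) r : R :=
  bexp (fun=> p) (box (0, 0) r.+1) (dsc r (0, 0)).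

(** A translation may exchange the two colours, but [disc] only involves colours relative to that of
    its centre, written [c (+) parity v] in the proof. *)
Lemma disc_shift r v X : dsc r v (shift v @` X) = dsc r (0, 0) X.
Proof.
have E (c : bool) : v |` (reg parity (c (+) parity v) (box v r) (box v r.+1) `&` shift v @` X) =
   shift v @` ((0, 0) |` (reg parity (c (+) parity (0, 0)) (box (0, 0) r) (box (0, 0) r.+1) `&` X)).
  have sv : v = shift v (0, 0) by case: (v) => x y; rewrite /shift /= !add0r.
  rewrite -!(shift_box v); apply/fsetP => u; apply/idP/imfsetP => /=.
    rewrite !inE => /predU1P[->|].
      by exists (0, 0); rewrite // !inE eqxx.
    move=> /andP[/andP[/imfsetP[w /= wB ->] hw] /imfsetP[w' /= wX /shift_inj ww]].
    exists w => //; rewrite !inE wB ww wX andbT; apply/orP; right.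
    move: hw; rewrite mem_imfset; last exact: shift_inj.
    by rewrite ww /parity /shift /=; case: c; lia.
  move=> [w + ->]; rewrite !inE => /predU1P[->|]; first by rewrite -sv eqxx.
  move=> /andP[/andP[wB hw] wX]; apply/orP; right.
  rewrite !mem_imfset ?wB ?wX //=; try exact: shift_inj.
  by move: hw; rewrite /parity /shift /= andbT; case: c; lia.
have key Y : hcq Z2adj lam (shift v @` Y) v = hcq Z2adj lam Y (0, 0).
  have sv : shift v (0, 0) = v by case: (v) => x y; rewrite /shift /= !add0r.
  rewrite -{2}sv (hcq_imfset lam Z2adj_sym Z2adj_irr Z2adj_sym Z2adj_irr (@shift_inj v)) //.
  by move=> x y; rewrite /Z2adj /shift /=; lia.
by rewrite /dsc /disc; have := E true; have := E false => /= -> ->; rewrite !key.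
Qed.

Lemma bexp_dsc p r v : bexp (fun=> p) (box v r.+1) (dsc r v) = mean_dsc p r.
Proof.
rewrite -shift_box bexp_imfset //; last exact: shift_inj.
by apply: eq_bexp => // S _; rewrite disc_shift.
Qed.

Lemma dsc_local r v X : dsc r v X = dsc r v (X `&` box v r.+1).
Proof. exact: disc_local. Qed.

Lemma dsc_ge0 r v X : 0 <= dsc r v X.
Proof. exact: (disc_ge0 Z2adj_sym Z2adj_irr lam0 Z2adj_parity). Qed.

Lemma mean_dsc_ge0 p r : 0 <= p <= 1 -> 0 <= mean_dsc p r.
Proof.
move=> p01; rewrite -[leLHS](bexp_cst (fun=> p) (box (0, 0) r.+1)).
by apply: ler_bexp => // S _; exact: dsc_ge0.
Qed.

Lemma sum_tilt_sqr (Q U : {fset int * int}) (p h : R) : Q `<=` U ->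
  \sum_(u <- U) (tilt Q p h u - p) ^+ 2 / (p * (1 - p)) =
  #|` Q|%:R * (h ^+ 2 / (p * (1 - p))).
Proof.
move=> QU; rewrite -(big_fset_incl _ QU) /=; last first.
  by move=> u _ /negbTE uQ; rewrite /tilt uQ subrr expr0n mul0r.
rewrite big_seq (eq_bigr (fun=> h ^+ 2 / (p * (1 - p)))); last first.
  by move=> u uQ; rewrite /tilt uQ addrAC subrr add0r.
by rewrite -big_seq big_const_seq count_predT iter_addr_0 mulr_natl.
Qed.

Lemma sum_tilt_norm (Q W : {fset int * int}) (p h : R) : 0 <= h ->
  \sum_(u <- W) `|tilt Q p h u - p| <= #|` W|%:R * h.
Proof.
move=> h0; apply: (@le_trans _ _ (\sum_(u <- W) h)).
  apply: ler_sum => u _; rewrite /tilt; case: ifP => _.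
    by rewrite addrAC subrr add0r ger0_norm.
  by rewrite subrr normr0.
by rewrite big_const_seq count_predT iter_addr_0 mulr_natl.
Qed.


(** Take [M] with mean within [d] of the infimum over all radii. Uniformity in [r] matters because
    the second radius will depend on [N], chosen after [M]. *)
Lemma mean_dsc_cauchy p (d : R) : 0 <= p <= 1 -> 0 < d ->
  exists M, forall r, mean_dsc p M - mean_dsc p r <= d.
Proof.
move=> p01 d0; pose E : set R := range (mean_dsc p).
have hE : has_inf E.
  split; first by exists (mean_dsc p 0), 0%N.
  by exists 0 => _ [r _ <-]; exact: mean_dsc_ge0.
have [_ [M _ <-] hM] := inf_adherent d0 hE.
exists M => r; have : inf E <= mean_dsc p r by apply: ge_inf hE.2 _ _; exists r.
lra.
Qed.

Lemma mean_dsc_small (p eps : R) : 0 < p < 1 -> 0 < eps ->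
  exists r, mean_dsc p r < eps.
Proof.
move=> /[dup] pp /andP[p0 p1] e0.
have p01 : 0 <= p <= 1 by rewrite !ltW.
apply: contrapT => /forallNP H.
have {}H r : eps <= mean_dsc p r by rewrite leNgt; apply/negP/H.
have ln0 : 0 <= ln (1 + lam) by rewrite ln_ge0 // lerDl.
(* With [h = K / N] the gain is [N * (24 * ln (1 + lam) + 1 / 2)], which beats the bound
   [24 * N * ln (1 + lam)] coming from [8 * N + 4 <= 12 * N] boundary vertices. *)
pose K := (48 * ln (1 + lam) + 1) / eps.
have K0 : 0 < K by rewrite divr_gt0 // ltr_wpDl // mulr_ge0.
(* [k] bounds the Cauchy-Schwarz exponent for at most [N * N] tilted vertices; [d] below makes the
   square root at most [eps / 4]. *)
pose k := K ^+ 2 / (p * (1 - p)).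
pose d := (eps / 4) ^+ 2 / expR k.
have d0 : 0 < d by rewrite divr_gt0 ?expR_gt0 // exprn_gt0 // divr_gt0.
have [M HM] := mean_dsc_cauchy p01 d0.
pose m : R := ((2 * M.+1).+1 * (2 * M.+1).+1)%:R.
have m0 : 0 <= m by rewrite ler0n.
have q0 : 0 < 1 - p by rewrite subr_gt0.
(* The first term gives [p + h <= 1]; the second makes the total variation over the [m] vertices of
   a box of radius [M + 1] at most [eps / 4]. So [eps / 2] of the disagreement survives. *)
have [N NR N1] : exists2 N : nat, K / (1 - p) + m * K * 4 / eps < N%:R & (0 < N)%N.
  by exists (Num.truncn (K / (1 - p) + m * K * 4 / eps)).+1; rewrite ?truncnS_gt.
have h1 : 0 <= K / (1 - p) by rewrite divr_ge0 ?ltW.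
have h2 : 0 <= m * K * 4 / eps.
  apply: divr_ge0 (ltW e0); apply: mulr_ge0; last by rewrite ler0n.
  by apply: mulr_ge0 => //; exact: ltW.
have N0 : 0 < N%:R :> R by rewrite ltr0n.
pose h := K / N%:R.
have h0 : 0 < h by rewrite divr_gt0.
have ph1 : p + h <= 1.
  rewrite addrC -lerBrDr ler_pdivrMr // [leRHS]mulrC -ler_pdivrMr //.
  by apply/ltW/(le_lt_trans _ NR); rewrite lerDl.
have mh : m * h <= eps / 4.
  rewrite mulrA ler_pdivrMr // [leRHS]mulrC -ler_pdivrMr ?divr_gt0 //.
  rewrite invf_div mulrA; apply/ltW/(le_lt_trans _ NR); rewrite lerDr //.
pose Lam := sq (0, 0) (2 * N); pose W := sq (0 - 1, 0 - 1) (2 * N).+2.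
(* Around any [v] of [Lam], the box of this radius contains both [Lam] and the box of radius [M]. *)
pose r1 := (2 * N + M)%N.
pose U := box (0, 0) (10 * N + 10 * M + 10).
have nW : nbd Z2adj Lam W by exact: nbd_sq.
have QL : even_pts N `<=` Lam.
  exact: even_pts_sq.
have nb : (2 * N <= 10 * N + 10 * M + 10)%N by clear; lia.
have LU : Lam `<=` U by exact: sq_sub_box0.
have QU : even_pts N `<=` U by exact: fsubset_trans QL LU.
have := @tilt_gain R _ Z2adj lam parity Z2adj_sym Z2adj_irr lam0 Z2adj_parity
  true Lam W U (even_pts N) p h (eps / 2) nW.1 QL QU _ (ltW p0) (ltW h0) ph1 _.
rewrite card_annulus card_even_pts => tg; suff : h * (N * N)%:R * (eps / 2) <=
    2 * ((8 * N + 4)%:R * ln (1 + lam)).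
  have -> : h * (N * N)%:R * (eps / 2) = N%:R * (24 * ln (1 + lam) + 1 / 2).
    by rewrite /h /K natrM; field; rewrite !gt_eqF.
  have : (8 * N + 4)%:R * ln (1 + lam) <= 12 * N%:R * ln (1 + lam).
    by rewrite ler_wpM2r // -natrM ler_nat; clear -N1; lia.
  set a := (8 * N + 4)%:R * _; set b := ln _; move: N0; set c := N%:R.
  clear; nra.
apply: tg => [v /even_ptsP[] //|Q' v /fsubsetP Q'Q vQ].
have vL : v \in Lam by exact: (fsubsetP QL).
have sub1 : box v M.+1 `<=` U by apply: box_sub_box0 vL _; clear; lia.
have sub2 : box v r1.+1 `<=` U by apply: box_sub_box0 vL _; rewrite /r1; clear; lia.
have sub3 : Lam `<=` box v r1 by exact: sq_sub_box.
have t01 u : 0 <= tilt Q' p h u <= 1 by apply: tilt01 => //; exact: ltW.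
have Q'U : Q' `<=` U by apply/fsubsetP => u /Q'Q; exact: (fsubsetP QU).
have Hk : \sum_(u <- U) (tilt Q' p h u - p) ^+ 2 / (p * (1 - p)) <= k.
  rewrite sum_tilt_sqr // /k /h expr_div_n.
  have -> : K ^+ 2 / (p * (1 - p)) = (N * N)%:R * (K ^+ 2 / N%:R ^+ 2 / (p * (1 - p))).
    by rewrite natrM; field; rewrite !gt_eqF.
  apply: ler_wpM2r; first by rewrite !divr_ge0 ?sqr_ge0 ?mulr_ge0 ?ltW.
  rewrite ler_nat -card_even_pts; apply: fsubset_leq_card.
  by apply/fsubsetP.
have := @bexp_disc_ge R _ Z2adj lam parity Z2adj_sym Z2adj_irr lam0 Z2adj_parity
  Lam W (box v M) (box v M.+1) (box v r1) (box v r1.+1) U v (tilt Q' p h) p k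
  nW (nbd_box _ _) (nbd_box _ _) (box_center _ _) vL
  (box_subset _ (leq_addl _ _)) sub3 sub1 sub2 t01 pp Hk.
apply: le_trans.
rewrite -/(dsc M v) -/(dsc r1 v) !bexp_dsc.
have hs : \sum_(u <- box v M.+1) `|tilt Q' p h u - p| <= eps / 4.
  by apply: le_trans mh; rewrite (le_trans (sum_tilt_norm _ _ _ (ltW h0))) // card_sq.
have hq : Num.sqrt (expR k * (mean_dsc p M - mean_dsc p r1)) <= eps / 4.
  have -> : eps / 4 = Num.sqrt ((eps / 4) ^+ 2).
    by rewrite sqrtr_sqr ger0_norm // divr_ge0 // ltW.
  apply: ler_wsqrtr.
  rewrite mulrC -ler_pdivlMr ?expR_gt0 //; exact: HM.
have := H M; move: hs hq; set x := \sum_(_ <- _) _; set y := Num.sqrt _; set z := mean_dsc _ _.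
by clear; lra.
Qed.

End imry_ma.

(** * Almost sure vanishing of the disagreement *)

Section percolation.
Local Open Scope classical_set_scope.
Local Open Scope ring_scope.
Variables (R : realType) (lam p : R).
Hypothesis lam0 : 0 <= lam.
Hypothesis p01 : 0 <= p < 1.
Variables (d : measure_display) (Omega : measurableType d) (P : probability Omega R).
Variable X : int * int -> {RV P >-> bool}.
Hypothesis hX : bernoulli_percolation p X.

Definition open_sites (x : int * int -> bool) (U : {fset int * int}) : {fset int * int} :=
  [fset v in U | x v]%fset.

Let conf w : int * int -> bool := fun v => X v w.

Lemma mem_open_sites x U v : (v \in open_sites x U) = (v \in U) && x v.
Proof. by rewrite !inE. Qed.

Lemma open_sites_sub x U : (open_sites x U `<=` U)%fset.
Proof. by apply/fsubsetP => v; rewrite !inE => /andP[]. Qed.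

Lemma perc_cylinderE (U S : {fset int * int}) : (S `<=` U)%fset ->
  [set w | open_sites (conf w) U = S] =
  \bigcap_(v in [set` U]) (X v @^-1` [set (v \in S)]).
Proof.
move=> /fsubsetP SU; apply/seteqP; split => [w /= <- v /= vU|w /= H].
  by rewrite /preimage /= !inE /= vU.
apply/fsetP => v; rewrite !inE; case: (boolP (v \in U)) => [vU|vU] /=.
  exact: (H v vU).
by apply/esym/negbTE/negP => /SU; exact/negP.
Qed.

Lemma measurable_perc_cylinder (U S : {fset int * int}) : (S `<=` U)%fset ->
  measurable [set w | open_sites (conf w) U = S].
Proof.
move=> SU; rewrite perc_cylinderE //; apply: fin_bigcap_measurable => //.
by move=> v _; exact: measurable_funPTI.
Qed.

Lemma perc_cylinder (U S : {fset int * int}) : (S `<=` U)%fset ->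
  P [set w | open_sites (conf w) U = S] =
  (\prod_(v <- U) (if v \in S then p else 1 - p))%:E.
Proof.
move=> SU; have [indX X1 X0] := hX.
rewrite perc_cylinderE // (indX U (fun v => [set (v \in S)])) // -prodEFin.
by apply: eq_bigr => v _; case: (v \in S); rewrite ?X1 ?X0.
Qed.

Lemma perc_eventE (U : {fset int * int}) (b : pred {fset int * int}) :
  [set w | b (open_sites (conf w) U)] =
  \bigcup_(S in [set` [fset S in fpowerset U | b S]%fset]) [set w | open_sites (conf w) U = S].
Proof.
apply/seteqP; split => [w /= bw|w [S /=]]; last by rewrite !inE => /andP[_ bS] ->.
exists (open_sites (conf w) U) => //=.
by rewrite !inE bw andbT fpowersetE open_sites_sub.
Qed.

Lemma measurable_perc_event (U : {fset int * int}) (b : pred {fset int * int}) :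
  measurable [set w | b (open_sites (conf w) U)].
Proof.
rewrite perc_eventE; apply: fin_bigcup_measurable => // S /=.
by rewrite !inE fpowersetE => /andP[SU _]; exact: measurable_perc_cylinder.
Qed.

Lemma perc_event (U : {fset int * int}) (b : pred {fset int * int}) :
  P [set w | b (open_sites (conf w) U)] =
  (bexp (fun=> p) U (fun S => (b S)%:R))%:E.
Proof.
rewrite perc_eventE measure_fin_bigcup //; last 2 first.
- by move=> S S' _ _ [w [/= -> ->]].
- by move=> S /=; rewrite !inE fpowersetE => /andP[SU _]; exact: measurable_perc_cylinder.
rewrite -fsbig_seq //= big_fset /=.
under eq_fbigr => S SU _.
  rewrite perc_cylinder; last by rewrite -fpowersetE.
  over.
rewrite sumEFin; congr EFin; rewrite /bexp big_mkcond.
by apply: eq_bigr => S _; case: (b S); rewrite ?mulr1 ?mulr0.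
Qed.

Let dscw r v w := dsc lam r v (open_sites (conf w) (box v r.+1)).

Let bad (n : nat) (v : int * int) : set Omega :=
  [set w | X v w /\ forall r, n.+1%:R^-1 <= dscw r v w].

(** Markov's inequality at a radius where the mean disagreement is below [e / (n + 1)], for
    arbitrary [e]. *)
Lemma bad_negligible n v : P.-negligible (bad n v).
Proof.
have mr r : measurable [set w | n.+1%:R^-1 <= dscw r v w].
  exact: (measurable_perc_event _ (fun S => n.+1%:R^-1 <= dsc lam r v S)).
have mX : measurable [set w | X v w].
  have -> : [set w | X v w] = X v @^-1` [set true] by [].
  exact: measurable_funPTI.
(* For [p = 0], which [mean_dsc_small] does not cover, [v] is almost surely closed. *)
have [p0|p0] := eqVneq p 0.
  exists [set w | X v w]; split => //; last by move=> w [].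
  have [_ X1 _] := hX; rewrite -[0%E]/(0%:E) -p0; exact: X1.
exists (\bigcap_r [set w | n.+1%:R^-1 <= dscw r v w]); split => //.
- exact: bigcap_measurable.
- have pp : 0 < p < 1 by move: p01; rewrite le_eqVlt eq_sym (negbTE p0).
  have p01' : 0 <= p <= 1 by case/andP: pp => ? ?; rewrite !ltW.
  apply/eqP; rewrite -measure_le0; apply/lee_addgt0Pr => e e0; rewrite add0e.
  have n0 : 0 < n.+1%:R^-1 :> R by rewrite invr_gt0.
  have [r hr] := mean_dsc_small lam0 pp (mulr_gt0 n0 e0).
  apply: (@le_trans _ _ (P [set w | n.+1%:R^-1 <= dscw r v w])).
    apply: le_measure; rewrite ?inE //; first exact: bigcap_measurable.
    by move=> w; apply.
  rewrite (perc_event _ (fun S => n.+1%:R^-1 <= dsc lam r v S)) lee_fin.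
  rewrite -(ler_pM2l n0) -bexpZ; apply/ltW/(le_lt_trans _ hr).
  rewrite -(bexp_dsc lam0 p r v); apply: ler_bexp => // S _.
  by case: (boolP (n.+1%:R^-1 <= dsc lam r v S)) => [h|_]; rewrite ?mulr1 ?mulr0 //; exact: dsc_ge0.
- by move=> w [_ h] r _; exact: h.
Qed.

Lemma perc_disagreement : {ae P, forall w, forall v, X v w -> forall eps, 0 < eps ->
  exists r, dsc lam r v (open_sites (fun v => X v w) (box v r.+1)) < eps}.
Proof.
(* A countable union over vertices and thresholds, indexed by the codes of the pairs. *)
pose F n : set Omega := if (choice.unpickle n : option (int * int * nat)) is Some vk
  then bad vk.2 vk.1 else set0.
have nF n : P.-negligible (F n).
  rewrite /F; case: choice.unpickle => [[v k]|]; first exact: bad_negligible.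
  exact: negligible_set0.
apply: negligibleS (negligible_bigcup nF) => w /= /existsNP[v] /not_implyP[Xv].
move=> /existsNP[eps] /not_implyP[e0 /forallNP H].
have [k hk] : exists k : nat, k.+1%:R^-1 <= eps.
  exists (Num.truncn eps^-1).
  by rewrite invf_ple ?posrE //; apply/ltW/truncnS_gt.
have Fk : F (choice.pickle (v, k)) = bad k v by rewrite /F choice.pickleK.
exists (choice.pickle (v, k)); first exact: I.
rewrite Fk; split; first exact: Xv.
move=> r; apply: le_trans hk _; rewrite leNgt; apply/negP; exact: (H r).
Qed.

End percolation.

(** * Events of the configuration space *)

Section sigma_coord_theory.
Local Open Scope classical_set_scope.
Variable V : countType.
Implicit Types (D : set V) (I : config V) (A C L : {fset V}).

(* The events [I cap A = 0]: a pi-system generating the sigma-algebra. *)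
Definition void A : set (config V) := [set I | all (fun v => ~~ I v) A].

Lemma voidP A I : void A I <-> forall v, v \in A -> I v = false.
Proof.
split=> [/allP H v /H /negbTE //|H]; rewrite /void /=.
by apply/allP => v /H ->.
Qed.

Lemma void0 : void fset0 = setT.
Proof. by apply/seteqP; split => // I _; apply/voidP. Qed.

Lemma voidI A C : void A `&` void C = void (A `|` C)%fset.
Proof.
apply/seteqP; split => [I [/voidP HA /voidP HC]|I /voidP H].
  by apply/voidP => v; rewrite !inE => /orP[/HA|/HC].
by split; apply/voidP => v vA; apply: H; rewrite !inE vA ?orbT.
Qed.

Definition voids D : set (set (config V)) :=
  [set void A | A in [set A : {fset V} | [set` A] `<=` D]].

Lemma sigma_coord_voids D : sigma_coord D = <<s voids D >>.
Proof.
apply/seteqP; split; apply: smallest_sub.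
- exact: smallest_sigma_algebra.
- move=> _ [v [b [Dv ->]]].
  have h : voids D (void [fset v]%fset).
    by exists [fset v]%fset => //= u; rewrite /= inE => /eqP ->.
  have -> : [set I : V -> bool | I v = b] = if b then ~` void [fset v]%fset else void [fset v]%fset.
    apply/seteqP; case: b; split => I /=.
    + by move=> Iv /voidP /(_ v); rewrite inE eqxx Iv => /(_ isT).
    + move=> H; apply: contrapT => /negP/negbTE Iv; apply: H; apply/voidP => u.
      by rewrite inE => /eqP ->.
    + by move=> Iv; apply/voidP => u; rewrite inE => /eqP ->.
    + by move=> /voidP; apply; rewrite inE.
  case: b; last exact: sub_sigma_algebra.
  rewrite -setTD; apply: (@sigma_algebraCD _ setT (voids D)); exact: sub_sigma_algebra.
- exact: smallest_sigma_algebra.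
move=> _ [A AD <-].
have -> : void A = \bigcap_(v in [set` A]) [set I : V -> bool | I v = false].
  apply/seteqP; split => [I /voidP H v /= /H //|I H].
  by apply/voidP => v vA; apply: (H v).
apply: (@fin_bigcap_measurable _ (g_sigma_algebraType (coordinate_events D))) => // v vA.
by apply: sub_sigma_algebra; exists v, false; split => //; apply: AD.
Qed.

Lemma setI_closed_voids D : setI_closed (voids D).
Proof.
move=> _ _ [A AD <-] [C CD <-]; exists (A `|` C)%fset; last by rewrite voidI.
by move=> v /=; rewrite inE => /orP[/AD|/CD].
Qed.

(** Dynkin's pi-lambda theorem for the void events. It gives uniqueness and extends the DLR equation
    from these events to the whole outer sigma-algebra. *)
Lemma sigma_coord_ind D (K : set (set (config V))) :
  (forall A, [set` A] `<=` D -> K (void A)) ->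
  (forall S, sigma_coord D S -> K S -> K (~` S)) ->
  (forall F : (set (config V))^nat, (forall n, sigma_coord D (F n)) ->
    trivIset setT F -> (forall n, K (F n)) -> K (\bigcup_k F k)) ->
  forall S, sigma_coord D S -> K S.
Proof.
move=> Kv KC KU S; rewrite sigma_coord_voids.
apply: (@dynkin_induction _ (g_sigma_algebraType (coordinate_events D)) (voids D)).
- exact: sigma_coord_voids.
- exact: setI_closed_voids.
- by rewrite -void0; apply: Kv => v.
- by move=> _ [A AD <-]; exact: Kv.
- exact: KC.
- exact: KU.
Qed.

Lemma sigma_coord_sub D D' : D `<=` D' -> sigma_coord D `<=` sigma_coord D'.
Proof.
move=> DD'; apply: sub_smallest2r; first exact: smallest_sigma_algebra.
by move=> _ [v [b [Dv ->]]]; exists v, b; split => //; apply: DD'.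
Qed.

Lemma sigma_coord_measurable D S : sigma_coord D S -> measurable (S : set (config V)).
Proof. exact: sigma_coord_sub. Qed.

Definition depends (T : Type) D (f : config V -> T) :=
  forall I I', (forall v, D v -> I v = I' v) -> f I = f I'.

Lemma sigma_coord_depends D S : sigma_coord D S -> depends D S.
Proof.
move: S; apply: sigma_coord_ind.
- move=> A AD I I' II'; apply/propext; split => /voidP H; apply/voidP => v vA.
    by rewrite -II' ?H //; apply: AD.
  by rewrite II' ?H //; apply: AD.
- by move=> S _ H I I' II'; rewrite /setC /= (H I I').
- move=> F _ _ H I I' II'; apply/propext; split=> -[k _ Fk]; exists k => //.
    by rewrite -(H k I I').
  by rewrite (H k I I').
Qed.

Definition conf (J : {fset V}) : config V := fun v => v \in J.

(** Such an event is a finite union of cylinders, one for each suitable subset [J] of [L]. *)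
Lemma depends_sigma_coord L (S : set (config V)) : depends [set` L] S -> sigma_coord [set` L] S.
Proof.
move=> dS.
have -> : S = \bigcup_(J in [set` [fset J in fpowerset L | `[< S (conf J) >]]%fset])
    \bigcap_(v in [set` L]) [set I : V -> bool | I v = (v \in J)].
  apply/seteqP; split => [I SI|I [J /=]].
    exists [fset v in L | I v]%fset => /=.
      rewrite !inE fpowersetE; apply/andP; split.
        by apply/fsubsetP => v; rewrite !inE => /andP[].
      apply/asboolP; rewrite (dS _ I) // => v /= vL.
      by rewrite /conf !inE vL.
    by move=> v /= vL; rewrite !inE vL.
  rewrite !inE fpowersetE => /andP[JL /asboolP SJ] H.
  by rewrite (dS _ (conf J)) // => v vL; apply: H.
apply: (@fin_bigcup_measurable _ (g_sigma_algebraType (coordinate_events [set` L]))) => // J _.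
apply: (@fin_bigcap_measurable _ (g_sigma_algebraType (coordinate_events [set` L]))) => // v vL.
by apply: sub_sigma_algebra; exists v, (v \in J).
Qed.

End sigma_coord_theory.

(** * Kolmogorov extension *)

Section kolmogorov_extension.
Local Open Scope classical_set_scope.
Local Open Scope ring_scope.
Variables (R : realType) (V : countType).

Definition local (T : Type) (f : config V -> T) :=
  exists L : {fset V}, depends [set` L] f.

Definition initial n : {fset V} :=
  [fset v in pmap (@choice.pickle_inv V) (iota 0 n)]%fset.

Lemma mem_initial n v : (v \in initial n) = (choice.pickle v < n)%N.
Proof.
rewrite !inE mem_pmap; apply/mapP/idP => [[k]|vn].
  rewrite mem_iota add0n => kn vk.
  by have := @choice.pickle_invK V k; rewrite -vk /= => ->.
by exists (choice.pickle v); rewrite ?mem_iota ?add0n // choice.pickleK_inv.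
Qed.

Lemma initial_exhausts (L : {fset V}) : exists n, (L `<=` initial n)%fset.
Proof.
elim/fset1U_rect: L => [|v L _ [n Ln]]; first by exists 0%N; rewrite fsub0set.
exists (maxn n (choice.pickle v).+1); apply/fsubsetP => u.
rewrite in_fset1U mem_initial leq_max => /predU1P[->|/(fsubsetP Ln)].
  by rewrite ltnSn orbT.
by rewrite mem_initial => ->.
Qed.

Lemma initial_mono n m : (n <= m)%N -> (initial n `<=` initial m)%fset.
Proof.
by move=> nm; apply/fsubsetP => v; rewrite !mem_initial => /leq_trans; apply.
Qed.

(* The restriction of a configuration to [initial n], listed from the last
   index to the first, with [false] at the indices that encode no vertex. *)
Fixpoint word n (I : config V) : seq bool :=
  if n is n'.+1 then
    (if choice.pickle_inv n' is Some v then I v else false) :: word n' I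
  else [::].

Lemma size_word n I : size (word n I) = n.
Proof. by elim: n => //= n ->. Qed.

Lemma word_depends n : depends [set` initial n] (word n).
Proof.
elim: n => //= n IH I I' II'.
rewrite (IH I I') => [|v /= vn]; last first.
  by apply: II' => /=; apply: (fsubsetP (initial_mono (leqnSn n))).
case E: choice.pickle_inv => [v|//]; congr (_ :: _); apply: II' => /=.
by rewrite mem_initial; have := @choice.pickle_invK V n; rewrite E /= => ->.
Qed.

Lemma word_inj n I I' : word n I = word n I' -> forall v, v \in initial n -> I v = I' v.
Proof.
elim: n => [_ v|n IH /= [h /IH {}IH] v]; rewrite mem_initial //.
rewrite ltnS leq_eqVlt => /predU1P[vn|vn]; last by apply: IH; rewrite mem_initial.
by move: h; rewrite -vn choice.pickleK_inv.
Qed.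

Lemma local_word (T : Type) n (F : seq bool -> T) : local (fun I => F (word n I)).
Proof. by exists (initial n) => I I' /word_depends ->. Qed.

Lemma localP (S : set (config V)) : local S ->
  exists n (b : pred (seq bool)), forall I, S I <-> b (word n I).
Proof.
move=> [L dS]; have [n Ln] := initial_exhausts L.
exists n, (fun w => `[< exists2 I, word n I = w & S I >]) => I; split.
  by move=> SI; apply/asboolP; exists I.
move=> /asboolP[I' /word_inj II' SI']; rewrite (dS I I') // => v /= vL.
by rewrite II' // (fsubsetP Ln).
Qed.

Variable ell : (config V -> R) -> R.
Hypothesis ell_ge0 : forall f, local f -> (forall I, 0 <= f I) -> 0 <= ell f.
Hypothesis ellD : forall f g, local f -> local g ->
  ell (fun I => f I + g I) = ell f + ell g.
Hypothesis ell1 : ell (fun=> 1) = 1.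

Lemma ell0 : ell (fun=> 0) = 0.
Proof.
have l0 : local (fun=> 0 : R) by exists fset0.
have := ellD l0 l0; under eq_fun do rewrite addr0.
by move=> /eqP; rewrite -subr_eq0 opprD addrA subrr sub0r oppr_eq0 => /eqP.
Qed.

Let m w : R := ell (fun I => (word (size w) I == w)%:R).

Let m_ge0 w : 0 <= m w.
Proof.
apply: ell_ge0 => [|I]; last by rewrite ler0n.
exact: (local_word (size w) (fun w' => (w' == w)%:R)).
Qed.

Let m_nil : m [::] = 1.
Proof. by rewrite /m /= -[RHS]ell1; congr ell; apply/funext. Qed.

Let m_split w : m w = m (false :: w) + m (true :: w).
Proof.
rewrite /m -ellD; first last.
- exact: (local_word (size w).+1 (fun w' => (w' == _)%:R)).
- exact: (local_word (size w).+1 (fun w' => (w' == _)%:R)).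
congr ell; apply/funext => I /=; rewrite !eqseq_cons.
by case: (if _ is Some _ then _ else _) => /=; rewrite ?add0r ?addr0.
Qed.

Let m_hole w : @choice.pickle_inv V (size w) = None -> m (true :: w) = 0.
Proof.
by move=> E; rewrite /m -[RHS]ell0; congr ell; apply/funext => I /=; rewrite E.
Qed.

(* Nested half-open intervals: the words of each length index a partition of
   [0, 1[ into intervals of lengths [m w], with left endpoints [lo w]. *)
Let lo := fix lo w : R :=
  if w is b :: w' then lo w' + (if b then m (false :: w') else 0) else 0.

(** The word of length [n] whose interval contains [u], found by successive subdivision. *)
Let digits := fix digits n (u : R) : seq bool :=
  if n is n'.+1 then
    let w := digits n' u in (lo w + m (false :: w) <= u) :: w
  else [::].

Let size_digits n u : size (digits n u) = n.
Proof. by elim: n => //= n ->. Qed.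

Let digits_in n u : 0 <= u < 1 ->
  lo (digits n u) <= u < lo (digits n u) + m (digits n u).
Proof.
move=> u01; elim: n => [|n IH]; first by rewrite /= m_nil add0r.
rewrite /=; set w := digits n u in IH *; move: IH; rewrite (m_split w).
case: (leP (lo w + m (false :: w)) u) => h /andP[h1 h2]; rewrite /= ?addr0.
  by rewrite h -addrA.
by rewrite h1 h.
Qed.

Let digits_of w u : lo w <= u < lo w + m w -> digits (size w) u = w.
Proof.
elim: w => //= b w IH; have := m_ge0 (false :: w); have := m_ge0 (true :: w).
have := m_split w => mw h1 h2 /andP[l1 l2].
have -> : digits (size w) u = w.
  by apply: IH; move: l1 l2; rewrite mw; case: b => *; apply/andP; split; lra.
congr (_ :: _); move: l1 l2; case: b => l1 l2; first by rewrite l1.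
by apply/negbTE; rewrite -ltNge; lra.
Qed.

Let lo_in w : 0 <= lo w /\ lo w + m w <= 1.
Proof.
elim: w => [|b w [h1 h2]] /=; first by rewrite m_nil add0r.
have := m_ge0 (false :: w); have := m_ge0 (true :: w); have := m_split w => mw.
by move=> *; case: b; split; lra.
Qed.

Let measurable_digits n (F : seq bool -> set R) :
  (forall w, measurable (F w)) -> measurable [set u | F (digits n u) u].
Proof.
elim: n F => [|n IH] F mF; first exact: mF.
pose c w := lo w + m (false :: w).
pose F' w := (`[c w, +oo[ `&` F (true :: w)) `|` (`]-oo, c w[ `&` F (false :: w)).
have mF' w : measurable (F' w).
  by apply: measurableU; apply: measurableI => //; exact: mF.
have := IH F' mF'; congr (measurable _).
apply/seteqP; split => u; rewrite /F' /= !in_itv /= ?andbT -/(c _).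
  by case: (leP (c _) u) => h [] [].
by case: (leP (c _) u) => h Fu; [left|right].
Qed.

Let sample (u : measurableTypeR R) : config V := fun v =>
  head false (digits (choice.pickle v).+1 u).

Let word_sample n u : 0 <= u < 1 -> word n (sample u) = digits n u.
Proof.
move=> u01; elim: n => //= n ->; congr (_ :: _).
case E: choice.pickle_inv => [v|].
  by rewrite /sample /=; have := @choice.pickle_invK V n; rewrite E /= => ->.
(* At an index that encodes no vertex the interval for [true] is empty, so the digit is [false], as
   in [word]. *)
have /andP[_] := digits_in n u01.
rewrite (m_split (digits n u)) m_hole ?size_digits // addr0.
by move=> ?; apply/esym/negbTE; rewrite -ltNge.
Qed.

Let measurable_sample : measurable_fun setT sample.
Proof.
apply: (@measurability _ _ _ (config V) setT sample (coordinate_events setT)) => //.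
move=> _ [_ [v [b [_ ->]]] <-]; rewrite setTI.
pose F w : set R := [set u | head false w = b].
have mF w : measurable (F w).
  have [h|h] := eqVneq (head false w) b.
    by rewrite [X in measurable X](_ : _ = setT) //; apply/seteqP; split.
  rewrite [X in measurable X](_ : _ = set0) //; apply/seteqP; split => // x /= xb.
  by rewrite xb eqxx in h.
exact: (measurable_digits (choice.pickle v).+1 mF).
Qed.

Let sampleM : {mfun measurableTypeR R >-> config V} := mfun_Sub (mem_set measurable_sample).

Let unif := uniform_prob (@ltr01 R).

Let measurable_word w : measurable [set u | word (size w) (sample u) = w].
Proof.
have mS : measurable ([set I | word (size w) I = w] : set (config V)).
  apply: (@sigma_coord_measurable _ [set` initial (size w)]).
  by apply: depends_sigma_coord => I I' /word_depends E; rewrite /mkset E.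
by have := measurable_sample measurableT mS; rewrite setTI.
Qed.

Let unif_word w : unif [set u | word (size w) (sample u) = w] = (m w)%:E.
Proof.
have mW := measurable_word w.
rewrite /unif /uniform_prob integral_uniform_pdf.
rewrite (eq_integral (fun=> 1%:E)); last first.
  move=> x; rewrite inE /= => -[_]; rewrite /= in_itv /= /uniform_pdf => ->.
  by rewrite subr0 invr1.
rewrite integral_cst ?mul1e; last exact: measurableI.
set W := [set u | _].
(* The uniform law lives on a closed interval while the partition is half-open; the endpoint 1 is
   split off as a null set. *)
have -> : W `&` `[0, 1] = `[lo w, lo w + m w[ `|` (W `&` [set 1]).
  have [l0 l1] := lo_in w.
  apply/seteqP; split => u.
    rewrite /= !in_itv /= => -[Wu /andP[u0]]; rewrite le_eqVlt => /predU1P[u1|u1].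
      by right.
    have u01 : 0 <= u < 1 by rewrite u0.
    have := digits_in (size w) u01; rewrite -word_sample // [word _ _]Wu => ?.
    by left.
  move=> [|[Wu u1]]; last first.
    by split=> //; rewrite [u]u1 /= in_itv /= ler01 lexx.
  rewrite /= !in_itv /= => /andP[u0 u1].
  have u01 : 0 <= u < 1 by rewrite (le_trans l0 u0) (lt_le_trans u1 l1).
  split; last by case/andP: u01 => -> /ltW.
  by rewrite /W /= word_sample // digits_of // u0.
rewrite measureU0 //; last 2 first.
- exact: measurableI.
- apply/eqP; rewrite -measure_le0 -(lebesgue_measure_set1 1) le_measure ?inE //.
  exact: measurableI.
transitivity (lebesgue_measure (`[lo w, lo w + m w[%classic : set R)); first by [].
rewrite lebesgue_measure_itv /= lte_fin ltrDl -EFinB addrAC subrr add0r.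
by case: ltP => // h; congr EFin; apply/eqP; rewrite eq_le h m_ge0.
Qed.

Let ell_sum n (b : pred (seq bool)) :
  ell (fun I => (b (word n I))%:R) = \sum_(w : n.-tuple bool | b w) m w.
Proof.
have E (r : seq (n.-tuple bool)) : ell (fun I => \sum_(w <- r | b w) (word n I == w)%:R) =
    \sum_(w <- r | b w) m w.
  elim: r => [|w r IH].
    by rewrite big_nil -[RHS]ell0; congr ell; apply/funext => I; rewrite big_nil.
  rewrite big_cons; case: ifPn => bw; last first.
    by rewrite -IH; congr ell; apply/funext => I; rewrite big_cons (negbTE bw).
  rewrite -IH /m size_tuple -ellD.
  - by congr ell; apply/funext => I; rewrite big_cons bw.
  - exact: (local_word n (fun w' => (w' == w)%:R)).
  - exact: (local_word n (fun w' => \sum_(w0 <- r | b w0) (w' == w0)%:R)).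
rewrite -E; congr ell; apply/funext => I.
have Hs : size (word n I) == n by rewrite size_word.
rewrite big_mkcond (bigD1 (Tuple Hs)) //= eqxx big1 ?addr0; first by case: ifP.
move=> w wI; case: ifP => // _; case: eqP => // wE; case/eqP: wI.
by apply: val_inj; exact: esym wE.
Qed.

(** The measure is the law of [sample] for a uniform [u], so countable additivity comes from
    Lebesgue measure. A local event is a finite disjoint union of word events, over which [ell] is
    additive. *)
Theorem kolmogorov_extension : exists mu : probability (config V) R,
  forall S : set (config V), local S -> mu S = (ell (fun I => (`[< S I >])%:R))%:E.
Proof.
exists (distribution unif sampleM) => S /localP[n [b Sb]].
have -> : (fun I => (`[< S I >])%:R : R) = (fun I => (b (word n I))%:R).
  by apply/funext => I; congr (_%:R); congr nat_of_bool; apply/asboolP/idP => /Sb.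
rewrite ell_sum /distribution /pushforward /=.
have -> : sample @^-1` S = \bigcup_(w in [set w : n.-tuple bool | b w])
    [set u | word (size w) (sample u) = w].
  apply/seteqP; split => [u /Sb bu|u [w /= bw]].
    have Hs : size (word n (sample u)) == n by rewrite size_word.
    by exists (Tuple Hs) => //=; rewrite size_word.
  by rewrite size_tuple => wu; apply/Sb; rewrite wu.
rewrite measure_fin_bigcup; first last.
- by move=> w _; exact: measurable_word.
- move=> w w' _ _ [u [/=]]; rewrite !size_tuple => -> ww; exact: val_inj.
- exact: finite_finset.
rewrite -sumEFin -(@bigfs _ _ _ _ (index_enum _) [pred w : n.-tuple bool | b w]).
- by apply: eq_bigr => w _; exact: unif_word.
- exact: index_enum_uniq.
- by move=> w _; rewrite mem_index_enum.
Qed.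

End kolmogorov_extension.

(** * Spatial Markov property of the hard-core sums *)

Section hcsum_splitting.
Local Open Scope fset_scope.
Local Open Scope ring_scope.
Variables (R : realType) (T : choiceType) (e : rel T) (lam : R).
Hypothesis esym : symmetric e.
Hypothesis eirr : irreflexive e.
Implicit Types (S L M N J : {fset T}) (F : {fset T} -> R).

Lemma hcsum_restrict S N F :
  hcsum e lam (S `\` N) F = hcsum e lam S (fun J => [disjoint J & N]%:R * F J).
Proof.
rewrite /hcsum [LHS]big_mkcond [RHS]big_mkcond.
rewrite -(@big_fset_incl _ _ _ _ (fpowerset (S `\` N)) (fpowerset S)) /=; last 2 first.
- by apply/fsubsetP => J; rewrite fpowersetCE fpowersetE => /andP[].
- move=> J; rewrite fpowersetCE fpowersetE => -> /= /negbTE ->.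
  by rewrite mul0r mulr0; case: ifP.
apply: eq_fbigr => J; rewrite fpowersetCE => /andP[_ ->] _.
by rewrite mul1r.
Qed.

Definition hit L J := [fset v in L | has (e v) J].

(** Given the part [J2] in [M], what remains is a hard-core sum on [L] without the neighbours of
    [J2]. Induction on the size of [L] by the deletion recursion. *)
Lemma hcsum_split L M F : [disjoint L & M] ->
  hcsum e lam (L `|` M) F =
  hcsum e lam M (fun J2 => hcsum e lam (L `\` hit L J2) (fun J1 => F (J1 `|` J2))).
Proof.
have [n] := ubnP #|` L|; elim: n L M F => // n IH L M F Ln LM.
have [->|/fset0Pn[v vL]] := eqVneq L fset0.
  rewrite fset0U; apply: eq_hcsum => J _ _; rewrite fset0D hcsum0 //.
  by rewrite fset0U.
have vM : v \notin M by apply: (fdisjointP LM).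
have [L' LE vL'] : exists2 L', L = v |` L' & v \notin L'.
  by exists (L `\ v); rewrite ?fsetD1K ?fsetD11.
have L'n : (#|` L'| < n)%N by move: Ln; rewrite LE cardfsU1 vL'.
have L'M : [disjoint L' & M].
  by apply: fdisjointWl LM; rewrite LE fsubsetU1.
rewrite LE -fsetUA hcsumU1 ?inE ?negb_or ?vL' //.
rewrite IH //.
have -> : (L' `|` M) `\` nbrs e (L' `|` M) v =
    (L' `\` nbrs e L' v) `|` (M `\` nbrs e M v).
  apply/fsetP => u; rewrite !inE.
  by case: (e v u); case: (u \in M); case: (u \in L').
rewrite IH; first last.
- apply: fdisjointWl (fdisjointWr _ L'M); first exact: fsubsetDl.
  exact: fsubsetDl.
- by rewrite (leq_ltn_trans _ L'n) // fsubset_leq_card // fsubsetDl.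
(* The term with [v] occupied only sees the [J2] avoiding the neighbours of [v], that is, those that
   do not hit [v]. *)
rewrite hcsum_restrict -hcsumZ -hcsumD; apply: eq_hcsum => J2 /fsubsetP J2M _.
have vJ2 : v \notin J2 by apply: contra vM; exact: J2M.
have hv : (v \in hit (v |` L') J2) = ~~ [disjoint J2 & nbrs e M v]%fset.
  rewrite !inE eqxx /=; apply/hasP/idP => [[u uJ2 evu]|].
    apply/negP => /fdisjointP /(_ u uJ2); rewrite nbrsE evu andbT.
    by rewrite J2M.
  rewrite -fsetI_eq0 => /fset0Pn[u]; rewrite inE nbrsE => /and3P[uJ2 _ evu].
  by exists u.
have [dJ|dJ] := boolP [disjoint J2 & nbrs e M v]%fset; rewrite dJ in hv.
  have -> : (v |` L') `\` hit (v |` L') J2 = v |` (L' `\` hit L' J2).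
    apply/fsetP => u; rewrite !in_fsetD !in_fset1U.
    have [->|uv] /= := eqVneq u v; first by rewrite hv.
    by rewrite !inE (negbTE uv).
  rewrite hcsumU1 ?inE ?(negbTE vL') ?andbF // mul1r.
  congr (_ + _ * _).
  have -> : L' `\` nbrs e L' v `\` hit (L' `\` nbrs e L' v) J2 =
      L' `\` hit L' J2 `\` nbrs e (L' `\` hit L' J2) v.
    apply/fsetP => u; rewrite !inE; case: (u \in L'); rewrite ?andbF //=.
    by case: (e v u); case: (has _ _).
  by apply: eq_hcsum => J1 _ _; rewrite fsetUA.
rewrite mul0r mulr0 addr0; congr (hcsum _ _ _ _).
apply/fsetP => u; rewrite !in_fsetD !in_fset1U.
have [->|uv] /= := eqVneq u v; first by rewrite hv (negbTE vL') andbF.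
by rewrite !inE (negbTE uv).
Qed.

Lemma hcsum_void S (A : {fset T}) : hcsum e lam S (fun J => (all (fun v => v \notin J) A)%:R) =
  hcZ e lam (S `\` A).
Proof.
rewrite /hcZ hcsum_restrict; apply: eq_hcsum => J _ _.
rewrite mulr1; congr (_%:R); congr nat_of_bool.
apply/allP/fdisjointP => [H v vJ|H v vA].
  by apply/negP => /H; rewrite vJ.
by apply/negP => /H; rewrite vA.
Qed.

End hcsum_splitting.

(** * DLR equations *)

Section gibbs_kernel.
Local Open Scope classical_set_scope.
Local Open Scope ring_scope.
Variables (R : realType) (V : countType) (G : rel V) (lam : R).
Hypotheses (Gsym : symmetric G) (Girr : irreflexive G) (lam0 : 0 <= lam).
Implicit Types (I : config V) (A C L J : {fset V}) (B : set (config V)).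

Definition blocked L I : {fset V} :=
  [fset v in L | `[< exists u, [/\ u \notin L, I u & G v u] >]]%fset.

Definition glue L J I : config V := fun v => if v \in L then v \in J else I v.

Lemma glue_in L J I v : v \in L -> glue L J I v = (v \in J).
Proof. by rewrite /glue => ->. Qed.

Lemma glue_out L J I v : v \notin L -> glue L J I v = I v.
Proof. by rewrite /glue => /negbTE ->. Qed.

(** [glue] is a bijection from the independent subsets of [L] without blocked vertices onto the
    support, so a boundary condition acts only by deleting vertices. *)
Lemma hc_support_sum L I B : indep_sets G (outside L I) ->
  \sum_(K \in hc_support G L (outside L I) `&` B) hc_weight lam L K =
  hcsum G lam (L `\` blocked L I)%fset (fun J => (`[< B (glue L J I) >])%:R).
Proof.
move=> iI.
pose P := [set` [fset J in fpowerset (L `\` blocked L I)%fset |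
  indepb G J && `[< B (glue L J I) >]]%fset].
have PE J : P J <-> [/\ (J `<=` L `\` blocked L I)%fset, indepb G J & B (glue L J I)].
  rewrite /P /= !inE fpowersetE.
  by split=> [/and3P[h1 h2 /asboolP h3]|[-> -> /= h3]] //; exact/asboolP.
have PL J v : P J -> v \in J -> v \in L /\ v \notin blocked L I.
  by move=> /PE[/fsubsetP JL _ _] /JL; rewrite in_fsetD => /andP[-> ->].
have bij : set_bij P (hc_support G L (outside L I) `&` B) (fun J => glue L J I).
  split.
  - move=> J PJ; have /PE[JL /indepbP iJ BJ] := PJ; split => //; split; last first.
      apply/funext => v; rewrite /outside /glue; case: (v \in L) => //.
    move=> u v; have [uL|uL] := boolP (u \in L); have [vL|vL] := boolP (v \in L).
    + by rewrite !glue_in //; exact: iJ.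
    + rewrite glue_in // glue_out // => uJ Iv; apply/negP => Guv.
      have [_ /negP] := PL _ _ PJ uJ; apply.
      by rewrite !inE uL /=; apply/asboolP; exists v.
    + rewrite glue_out // glue_in // => Iu vJ; apply/negP => Guv.
      have [_ /negP] := PL _ _ PJ vJ; apply.
      by rewrite !inE vL /=; apply/asboolP; exists u; rewrite Gsym.
    + by rewrite !glue_out // => Iu Iv; apply: iI; rewrite /outside ?uL ?vL.
  - move=> J J' /set_mem PJ /set_mem PJ' JJ'; apply/fsetP => v.
    have := congr1 (fun K : config V => K v) JJ'; rewrite /glue.
    case: (boolP (v \in L)) => // vL _; apply/idP/idP => vJ.
      by have [] := PL _ _ PJ vJ; rewrite (negbTE vL).
    by have [] := PL _ _ PJ' vJ; rewrite (negbTE vL).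
  - move=> K [[iK oK] BK]; exists [fset v in L | K v]%fset; last first.
      apply/funext => v; rewrite /glue; case: (boolP (v \in L)) => vL; first by rewrite !inE vL.
      have := congr1 (fun K : config V => K v) oK; rewrite /outside.
      by rewrite (negbTE vL).
    have gK : glue L [fset v in L | K v]%fset I = K.
      apply/funext => v; rewrite /glue; case: (boolP (v \in L)) => vL; first by rewrite !inE vL.
      have := congr1 (fun K : config V => K v) oK; rewrite /outside.
      by rewrite (negbTE vL).
    apply/PE; rewrite gK; split => //.
      apply/fsubsetP => v; rewrite in_fsetD !inE => /andP[vL Kv]; rewrite vL andbT /=.
      apply/asboolPn => -[u [uL Iu Gvu]].
      have Ku : K u.
        by have := congr1 (fun K : config V => K u) oK; rewrite /outside uL /= => ->.
      by have := iK v u Kv Ku; rewrite Gvu.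
    apply/indepbP => u v; rewrite !inE => /andP[_ Ku] /andP[_ Kv]; exact: iK.
rewrite (reindex_fsbig _ _ _ _ bij) -fsbig_seq //= big_fset /hcsum /=.
rewrite [LHS]big_mkcond [RHS]big_mkcond; apply: eq_fbigr => J.
rewrite fpowersetE => /fsubsetP JL _.
case: (indepb G J) => //=; case: asboolP => BJ; rewrite ?mulr0 // mulr1.
rewrite /hc_weight; congr (_ ^+ size (enum_fset _)); apply/fsetP => v.
rewrite !inE /glue; case: (boolP (v \in L)) => vL //=.
by apply/esym/negP => /JL; rewrite in_fsetD (negbTE vL) andbF.
Qed.

(** The kernel as a function of the blocked set alone; for given [L] and [B] it takes finitely many
    values. *)
Definition gam L B (N : {fset V}) : R :=
  hcsum G lam (L `\` N)%fset (fun J => (`[< B (conf J) >])%:R) / hcZ G lam (L `\` N)%fset.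

Lemma gam_ge0 L B N : 0 <= gam L B N.
Proof.
apply: divr_ge0; last exact: hcZ_ge0.
by apply: sumr_ge0 => J _; rewrite mulr_ge0 ?exprn_ge0.
Qed.

Definition indep_out L : set (config V) := [set I | indep_sets G (outside L I)].

(** If the outside configuration is not independent, the support is empty and [hc_measure] is
    [0 / 0], which is 0 by convention; hence the indicator. *)
Lemma hc_measureE L I B : sigma_coord [set` L] B ->
  hc_measure G lam L (outside L I) B =
  ((`[< indep_out L I >])%:R * gam L B (blocked L I))%:E.
Proof.
move=> sB; rewrite /hc_measure; congr EFin.
have outK : outside L (outside L I) = outside L I.
  by apply/funext => v; rewrite /outside; case: (v \in L).
case: asboolP => [iI|iI]; last first.
  rewrite (_ : hc_support G L (outside L I) = set0) ?set0I ?fsbig_set0 ?mul0r //.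
  apply/seteqP; split => // K [iK oK]; apply: iI => u v; rewrite -outK -oK /outside.
  by move=> /andP[_ Ku] /andP[_ Kv]; exact: iK.
rewrite mul1r hc_support_sum //; congr (_ / _).
  apply: eq_hcsum => J _ _; congr (_%:R); congr nat_of_bool; congr asbool.
  by apply: (sigma_coord_depends sB) => v /= vL; rewrite glue_in.
have -> : hc_support G L (outside L I) = hc_support G L (outside L I) `&` setT by rewrite setIT.
rewrite hc_support_sum //; apply: eq_hcsum => J _ _.
by rewrite asboolT.
Qed.

Variable nb : V -> {fset V}.
Hypothesis Gnb : forall u w, G u w -> w \in nb u.

Definition bd L : {fset V} := ((\bigcup_(v <- L) nb v) `\` L)%fset.

Lemma bdP L u v : v \in L -> G v u -> u \notin L -> u \in bd L.
Proof.
move=> vL Gvu uL; rewrite inE uL /=; apply/bigfcupP; exists v; rewrite ?vL //.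
exact: Gnb.
Qed.

Lemma blocked_depends L : depends [set` bd L] (blocked L).
Proof.
move=> I I' II'; apply/fsetP => v; rewrite !inE.
case: (boolP (v \in L)) => //= vL.
apply/asboolP/asboolP => -[u [uL Iu Gvu]]; exists u; split => //.
  by rewrite -II' //; exact: bdP Gvu uL.
by rewrite II' //; exact: bdP Gvu uL.
Qed.

Lemma bd_out L : [set` bd L] `<=` ~` [set` L].
Proof. by move=> v /=; rewrite inE => /andP[/negP]. Qed.

Lemma indep_out_sigma L : sigma_coord (~` [set` L]) (indep_out L).
Proof.
pose E (u v : V) : set (config V) :=
  [set I | u \notin L -> v \notin L -> G u v -> ~~ (I u && I v)].
pose F n : set (config V) :=
  if (choice.unpickle n : option (V * V)) is Some uv then E uv.1 uv.2 else setT.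
have EE u v : sigma_coord (~` [set` L]) (E u v).
  have [[uL vL]|uvL] := pselect (u \notin L /\ v \notin L); last first.
    rewrite (_ : E u v = setT).
      exact: (@measurableT _ (g_sigma_algebraType (coordinate_events (~` [set` L])))).
    by apply/seteqP; split => // I _ uL vL; exfalso; apply: uvL.
  apply: (@sigma_coord_sub _ [set` [fset u; v]%fset]).
    by move=> x /=; rewrite !inE => /orP[] /eqP ->; exact/negP.
  apply: depends_sigma_coord => I I' II'; rewrite /E /=.
  by rewrite (II' u) ?(II' v) //= !inE eqxx ?orbT.
have -> : indep_out L = \bigcap_n F n.
  apply/seteqP; split => [I iI n _|I HI u v].
    rewrite /F; case: choice.unpickle => [[u v]|] //= uL vL Guv.
    apply/negP => /andP[Iu Iv].
    by have := iI u v; rewrite /outside uL vL Iu Iv Guv => /(_ isT isT).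
  rewrite /outside => /andP[uL Iu] /andP[vL Iv]; apply/negP => Guv.
  have := HI (choice.pickle (u, v)) Logic.I; rewrite /F choice.pickleK /E /=.
  by rewrite Iu Iv => /(_ uL vL Guv).
apply: (@bigcap_measurable _ (g_sigma_algebraType (coordinate_events (~` [set` L])))) => //.
move=> n _; rewrite /F; case: choice.unpickle => [[u v]|]; first exact: EE.
exact: (@measurableT _ (g_sigma_algebraType (coordinate_events (~` [set` L])))).
Qed.

Lemma measurable_indep_sets : measurable (indep_sets G : set (config V)).
Proof.
have -> : indep_sets G = indep_out fset0.
  by apply/seteqP; split => I; rewrite /indep_out /= (_ : outside fset0 I = I) //;
    apply/funext => v; rewrite /outside inE.
apply: (@sigma_coord_measurable _ (~` [set` (fset0 : {fset V})])).
exact: indep_out_sigma.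
Qed.

Lemma hc_measure_sigma L B : sigma_coord [set` L] B ->
  preimage_set_system setT (fun I => hc_measure G lam L (outside L I) B)
    measurable `<=` sigma_coord (~` [set` L]).
Proof.
move=> sB _ [Y mY <-]; rewrite setTI.
pose M := g_sigma_algebraType (coordinate_events (~` [set` L])).
(* The kernel is 0 off [indep_out L], and on it depends only on the coordinates in [bd L]. *)
have -> : (fun I => hc_measure G lam L (outside L I) B) @^-1` Y =
  (indep_out L `&` [set I | Y (gam L B (blocked L I))%:E]) `|`
  (~` indep_out L `&` [set I | Y 0%:E]).
  apply/seteqP; split => I; rewrite /preimage /= hc_measureE //.
    by case: asboolP => iI; rewrite ?mul1r ?mul0r => h; [left|right].
  by move=> [[iI YI]|[iI YI]]; [rewrite asboolT // mul1r|rewrite asboolF // mul0r].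
apply: (@measurableU _ M).
  apply: (@measurableI _ M); first exact: indep_out_sigma.
  apply: (sigma_coord_sub (@bd_out L)); apply: depends_sigma_coord.
  by move=> I I' /blocked_depends h; rewrite /= h.
apply: (@measurableI _ M).
  by apply: (@measurableC _ M); exact: indep_out_sigma.
have [Y0|Y0] := pselect (Y 0%:E).
  have -> : [set I : config V | Y 0%:E] = setT by apply/seteqP; split.
  exact: (@measurableT _ M).
have -> : [set I : config V | Y 0%:E] = set0 by apply/seteqP; split.
exact: (@measurable0 _ M).
Qed.

Lemma measurable_hc_measure L B : sigma_coord [set` L] B ->
  measurable_fun setT (fun I : config V => hc_measure G lam L (outside L I) B).
Proof.
move=> sB _ Y mY; apply: (@sigma_coord_measurable _ (~` [set` L])).
by apply: (hc_measure_sigma sB); exists Y.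
Qed.

Lemma hc_measure_ge0 L B I : sigma_coord [set` L] B ->
  (0 <= hc_measure G lam L (outside L I) B)%E.
Proof. by move=> sB; rewrite hc_measureE // lee_fin mulr_ge0 ?gam_ge0. Qed.

End gibbs_kernel.

(** * Uniqueness from the convergence of vacancy probabilities *)

Section gibbs_measures.
Local Open Scope classical_set_scope.
Local Open Scope ring_scope.
Variables (R : realType) (V : countType) (G : rel V) (lam : R).
Hypotheses (Gsym : symmetric G) (Girr : irreflexive G) (lam0 : 0 <= lam).
Variable nb : V -> {fset V}.
Hypothesis Gnb : forall u w, G u w -> w \in nb u.
Hypothesis hcr_conv : forall (A : {fset V}) (eps : R), 0 < eps ->
  exists Lam, forall S S', (Lam `<=` S)%fset -> (Lam `<=` S')%fset ->
    `|hcr G lam S A - hcr G lam S' A| <= eps.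
Implicit Types (I : config V) (A C L J S : {fset V}) (B : set (config V)).

Lemma void_sigma (D : set V) A : [set` A] `<=` D -> sigma_coord D (void A).
Proof. by move=> AD; rewrite sigma_coord_voids; apply: sub_sigma_algebra; exists A. Qed.

Lemma void_conf A J : `[< void A (conf J) >] = all (fun v => v \notin J) A.
Proof. by apply/asboolP/idP. Qed.

Lemma gam_void L A N : gam G lam L (void A) N = hcr G lam (L `\` N)%fset A.
Proof.
rewrite /gam /hcr; congr (_ / _).
have <- := hcsum_void G lam (L `\` N)%fset A.
by apply: eq_hcsum => J _ _; rewrite void_conf.
Qed.

(** By the DLR equation [mu (void A)] is a mean of kernel values, almost all of which are vacancies
    of [A] in sets containing [Lam], hence within [eps] of [hcr G lam S A]. *)
Lemma gibbs_void (mu : probability (config V) R) A (eps : R) :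
  hc_gibbs G lam mu -> 0 < eps ->
  exists Lam, forall S, (Lam `<=` S)%fset -> `|fine (mu (void A)) - hcr G lam S A| <= eps.
Proof.
move=> [mu1 dlr] e0; have [Lam HL] := hcr_conv A e0; exists Lam => S LS.
(* With the neighbours of [Lam] inside [L], no vertex of [Lam] can be blocked. *)
pose L := (Lam `|` A `|` \bigcup_(v <- Lam) nb v)%fset.
set c := hcr G lam S A; pose f I := hc_measure G lam L (outside L I) (void A).
have sB : sigma_coord [set` L] (void A).
  by apply: void_sigma => v /= vA; rewrite !in_fsetU vA !orbT.
have fE I : f I = ((`[< indep_out G L I >])%:R * hcr G lam (L `\` blocked G L I)%fset A)%:E.
  by rewrite /f hc_measureE // gam_void.
have LamL I : (Lam `<=` L `\` blocked G L I)%fset.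
  apply/fsubsetP => v vLam; rewrite in_fsetD !in_fsetU vLam /= andbT.
  apply/negP => vb; have [u [uL _ Guv]] : exists u, [/\ u \notin L, I u & G v u].
    by move: vb; rewrite inE => /andP[_ /asboolP].
  case/negP: uL; rewrite !in_fsetU; apply/orP; right.
  by apply/bigfcupP; exists v; rewrite ?vLam //; exact: Gnb.
have hcb I : `|hcr G lam (L `\` blocked G L I)%fset A - c| <= eps by exact: HL.
have c0 : 0 <= c by rewrite ltW // hcr_gt0.
have mf : measurable_fun setT f by exact: (measurable_hc_measure lam Gsym Gnb sB).
have f0 I : (0 <= f I)%E by exact: hc_measure_ge0.
have muf : (\int[mu]_(I in setT) f I)%E = mu (void A).
  have [_ /(_ setT)] := dlr L (void A) sB; rewrite setTI; apply.
  by rewrite -void0; apply: void_sigma => v.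
have mfin : mu (void A) \is a fin_num by exact: fin_num_measure (sigma_coord_measurable sB).
have up : (mu (void A) <= (c + eps)%:E)%E.
  rewrite -muf; apply: (@le_trans _ _ (\int[mu]_(I in setT) (cst (c + eps)%:E) I)%E).
    apply: ge0_le_integral => //= I _.
    rewrite fE lee_fin; have := hcb I; rewrite ler_distl => /andP[_ h].
    by case: asboolP => _; rewrite ?mul1r // mul0r addr_ge0 // ltW.
  rewrite integral_cst // [X in (_ * X)%E](_ : _ = 1%E) ?mule1 //.
  exact: probability_setT.
have mI : measurable (indep_sets G : set (config V)) by exact: (measurable_indep_sets G).
(* The kernel may vanish when [I] is not independent, so one integrates over [indep_sets G], of mass
   1. A negative [c - eps] is treated apart to compare nonnegative integrals. *)
have lo : ((c - eps)%:E <= mu (void A))%E.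
  have [h|h] := leP (c - eps) 0; first by rewrite (@le_trans _ _ 0%E) ?lee_fin.
  rewrite -muf; apply: (@le_trans _ _ (\int[mu]_(I in indep_sets G) f I)%E); last first.
    exact: ge0_subset_integral.
  apply: (@le_trans _ _ (\int[mu]_(I in indep_sets G) (cst (c - eps)%:E) I)%E).
    by rewrite integral_cst // [X in (_ * X)%E](_ : _ = 1%E) ?mule1.
  apply: ge0_le_integral => //=.
  - by move=> I _; rewrite lee_fin ltW.
  - exact: measurable_funTS.
  - move=> I iI; rewrite fE lee_fin asboolT ?mul1r.
      by have := hcb I; rewrite ler_distl => /andP[].
    by move=> u v /andP[_ Iu] /andP[_ Iv]; exact: iI.
move: up lo; rewrite -(fineK mfin) !lee_fin => up lo.
by rewrite ler_distl lo up.
Qed.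

Lemma gibbs_unique (mu nu : probability (config V) R) :
  hc_gibbs G lam mu -> hc_gibbs G lam nu ->
  forall E : set (config V), measurable E -> nu E = mu E.
Proof.
move=> gmu gnu; apply: (@sigma_coord_ind V setT).
- move=> A _; have mA : measurable (void A : set (config V)).
    by apply: (@sigma_coord_measurable _ setT); exact: void_sigma.
  rewrite -(fineK (fin_num_measure nu _ mA)) -(fineK (fin_num_measure mu _ mA)).
  congr EFin; apply/eqP; rewrite -subr_eq0 -normr_le0; apply/ler_addgt0Pr => e e0.
  have e2 : 0 < e / 2 by rewrite divr_gt0.
  have [L1 H1] := gibbs_void A gmu e2; have [L2 H2] := gibbs_void A gnu e2.
  have := H1 (L1 `|` L2)%fset (fsubsetUl _ _); have := H2 (L1 `|` L2)%fset (fsubsetUr _ _).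
  rewrite add0r !ler_distl => /andP[? ?] /andP[? ?].
  by apply/andP; split; lra.
- move=> S mS E; have mS' : measurable (S : set (config V)) by [].
  by rewrite !probability_setC // E.
- move=> F mF tF E; have mF' n : measurable (F n : set (config V)) by exact: mF.
  rewrite !measure_bigcup //.
  by apply: eq_eseriesr => n _; exact: E.
Qed.

End gibbs_measures.

(** * Existence: the limit of the finite-volume averages is a Gibbs measure *)

Section gibbs_existence.
Local Open Scope classical_set_scope.
Local Open Scope ring_scope.
Variables (R : realType) (V : countType) (G : rel V) (lam : R).
Hypotheses (Gsym : symmetric G) (Girr : irreflexive G) (lam0 : 0 <= lam).
Variable nb : V -> {fset V}.
Hypothesis Gnb : forall u w, G u w -> w \in nb u.
Hypothesis hcr_conv : forall (A : {fset V}) (eps : R), 0 < eps ->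
  exists Lam, forall S S', (Lam `<=` S)%fset -> (Lam `<=` S')%fset ->
    `|hcr G lam S A - hcr G lam S' A| <= eps.
Implicit Types (I : config V) (A C L J S N : {fset V}) (B : set (config V)).
Implicit Types (f g : config V -> R).

Lemma local2 (T1 T2 T3 : Type) (h : T1 -> T2 -> T3)
    (f1 : config V -> T1) (f2 : config V -> T2) :
  local f1 -> local f2 -> local (fun I => h (f1 I) (f2 I)).
Proof.
move=> [L1 d1] [L2 d2]; exists (L1 `|` L2)%fset => I I' II'.
rewrite (d1 I I') ?(d2 I I') // => v /= vL; apply: II' => /=; rewrite inE vL ?orbT //.
Qed.

Lemma local_cst (T : Type) (c : T) : local (fun _ : config V => c).
Proof. by exists fset0. Qed.

Lemma local_comp (T1 T2 : Type) (h : T1 -> T2) (f : config V -> T1) :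
  local f -> local (fun I => h (f I)).
Proof. by move=> lf; exact: (local2 (fun x _ => h x) lf lf). Qed.

Lemma local_void A : local (void A).
Proof.
by exists A; apply: sigma_coord_depends; apply: void_sigma.
Qed.

Lemma local_blocked L : local (blocked G L).
Proof. by exists (bd nb L); exact: (blocked_depends Gnb). Qed.

Definition avg f n : R :=
  hcsum G lam (initial V n) (fun J => f (conf J)) / hcZ G lam (initial V n).

Lemma avgD f g n : avg (fun I => f I + g I) n = avg f n + avg g n.
Proof. by rewrite /avg hcsumD mulrDl. Qed.

Lemma avgZ a f n : avg (fun I => a * f I) n = a * avg f n.
Proof. by rewrite /avg hcsumZ mulrA. Qed.

Lemma avg_cst c n : avg (fun=> c) n = c.
Proof.
have -> : (fun=> c) = (fun _ : config V => c * 1) by apply/funext => I; rewrite mulr1.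
by rewrite avgZ /avg divff ?mulr1 // gt_eqF // hcZ_gt0.
Qed.

Lemma avg_void A n : avg (fun I => (`[< void A I >])%:R) n = hcr G lam (initial V n) A.
Proof.
rewrite /avg /hcr; congr (_ / _).
have <- := hcsum_void G lam (initial V n) A.
by apply: eq_hcsum => J _ _; rewrite void_conf.
Qed.

Lemma cvg_avg_void A : cvgn (avg (fun I => (`[< void A I >])%:R)).
Proof.
apply/cauchy_cvgP/cauchy_exP => _/posnumP[e].
have e2 : 0 < e%:num / 2 by rewrite divr_gt0.
have [Lam HL] := hcr_conv A e2; have [n Hn] := initial_exhausts Lam.
exists (avg (fun I => (`[< void A I >])%:R) n).
exists n => // k /= nk; rewrite /ball /= !avg_void.
have h : `|hcr G lam (initial V n) A - hcr G lam (initial V k) A| <= e%:num / 2.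
  by apply: HL => //; apply: fsubset_trans Hn _; exact: initial_mono.
by apply: le_lt_trans h _; rewrite ltr_pdivrMr // ltr_pMr // ltr1n.
Qed.

Let with_val v b I : config V := fun u => if u == v then b else I u.

(** The void factor makes the induction on [L] close: [f] is [f1] plus [f0 - f1] times the indicator
    that [v] is vacant, where [f0] and [f1] do not depend on [v], and this indicator is absorbed
    into [A]. *)
Lemma cvg_avg_local_void L f A : depends [set` L] f ->
  cvgn (avg (fun I => f I * (`[< void A I >])%:R)).
Proof.
elim/fset1U_rect: L f A => [|v L vL IH] f A df.
  have -> : (fun I => f I * (`[< void A I >])%:R) =
      (fun I => f (conf fset0) * (`[< void A I >])%:R).
    by apply/funext => I; rewrite (df I (conf fset0)).
  rewrite (_ : avg _ = (fun n => f (conf fset0) * avg (fun I => (`[< void A I >])%:R) n)).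
    by apply: is_cvgMr; exact: cvg_avg_void.
  by apply/funext => n; rewrite avgZ.
pose f0 I := f (with_val v false I); pose f1 I := f (with_val v true I).
have dw b : depends [set` L] (fun I => f (with_val v b I)).
  move=> I I' II'; apply: df => u /=; rewrite in_fset1U /with_val.
  by case: (eqVneq u v) => //= _; exact: II'.
have E : (fun I => f I * (`[< void A I >])%:R) =
  (fun I => f1 I * (`[< void A I >])%:R + (f0 I - f1 I) * (`[< void (v |` A)%fset I >])%:R).
  apply/funext => I; rewrite -voidI.
  have -> : `[< (void [fset v]%fset `&` void A) I >] = ~~ I v && `[< void A I >].
    apply/asboolP/andP => [[/voidP Hv HA]|[Iv /asboolP HA]].
      by split; [rewrite Hv ?inE|exact/asboolP].
    by split => //; apply/voidP => u; rewrite inE => /eqP ->; exact: negbTE.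
  have fI : f I = if I v then f1 I else f0 I.
    rewrite /f1 /f0; case: ifPn => [Iv|/negbTE Iv]; congr f; apply/funext => u;
      by rewrite /with_val; case: eqVneq => // ->.
  rewrite fI; case: (I v) => /=; first by rewrite mulr0 addr0.
  ring.
rewrite E (_ : avg _ = avg (fun I => f1 I * (`[< void A I >])%:R) \+
    avg (fun I => (f0 I - f1 I) * (`[< void (v |` A)%fset I >])%:R)); last first.
  by apply/funext => n; rewrite avgD.
apply: is_cvgD; apply: IH; first exact: dw.
by move=> I I' II'; rewrite /f0 /f1 (dw _ _ _ II') (dw true _ _ II').
Qed.

Lemma cvg_avg f : local f -> cvgn (avg f).
Proof.
move=> [L df]; have -> : f = (fun I => f I * (`[< void fset0 I >])%:R).
  by apply/funext => I; rewrite asboolT ?mulr1 // void0.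
exact: cvg_avg_local_void df.
Qed.

Definition limit_mean f : R := limn (avg f).

Lemma limit_meanD f g : local f -> local g ->
  limit_mean (fun I => f I + g I) = limit_mean f + limit_mean g.
Proof.
move=> lf lg; rewrite /limit_mean (_ : avg _ = avg f \+ avg g); last first.
  by apply/funext => n; rewrite avgD.
by rewrite limD //; exact: cvg_avg.
Qed.

Lemma limit_meanZ a f : local f -> limit_mean (fun I => a * f I) = a * limit_mean f.
Proof.
move=> lf; rewrite /limit_mean (_ : avg _ = (fun n => a * avg f n)); last first.
  by apply/funext => n; rewrite avgZ.
by rewrite limZr //; exact: cvg_avg.
Qed.

Lemma limit_mean_cst c : limit_mean (fun=> c) = c.
Proof.
rewrite /limit_mean (_ : avg _ = cst c); first exact: lim_cst.
by apply/funext => n; rewrite avg_cst.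
Qed.

Lemma limit_mean_ge0 f : local f -> (forall I, 0 <= f I) -> 0 <= limit_mean f.
Proof.
move=> lf f0; apply: limr_ge; first exact: cvg_avg.
near=> n; apply: divr_ge0; last exact: hcZ_ge0.
by apply: sumr_ge0 => J _; rewrite mulr_ge0 ?exprn_ge0.
Unshelve. all: by end_near. Qed.

Lemma eq_limit_mean f g n : (forall k, (n <= k)%N -> avg f k = avg g k) ->
  local g -> limit_mean f = limit_mean g.
Proof.
move=> fg lg; apply/cvg_lim => //; have := cvg_avg lg.
apply: cvg_trans; apply: near_eq_cvg; near=> k.
by rewrite fg //; near: k; exact: nbhs_infty_ge.
Unshelve. all: by end_near. Qed.

Lemma limit_mean_sum (r : seq {fset V}) (c : {fset V} -> R) (h : {fset V} -> config V -> R) :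
  (forall N, local (h N)) ->
  local (fun I => \sum_(N <- r) c N * h N I) /\
  limit_mean (fun I => \sum_(N <- r) c N * h N I) = \sum_(N <- r) c N * limit_mean (h N).
Proof.
move=> lh; elim: r => [|N r [IH1 IH2]].
  rewrite big_nil; under eq_fun do rewrite big_nil.
  by split; [exact: local_cst|exact: limit_mean_cst].
rewrite big_cons; under eq_fun do rewrite big_cons.
have lN : local (fun I => c N * h N I) by exact: local_comp.
split; first exact: (local2 +%R).
by rewrite limit_meanD // limit_meanZ // IH2.
Qed.

(** Apply [hcsum_split]. Given [J2] outside [L], the blocked set is [hit G L J2], [void C] is
    decided, and the normalisation of [gam] cancels the sum inside [L]. *)
Lemma finite_dlr L S C B : sigma_coord [set` L] B -> (L `<=` S)%fset ->
  [disjoint C & L]%fset ->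
  hcsum G lam S (fun J => (`[< void C (conf J) >])%:R * gam G lam L B (blocked G L (conf J))) =
  hcsum G lam S (fun J => (`[< void C (conf J) >])%:R * (`[< B (conf J) >])%:R).
Proof.
move=> sB LS CL; have LSL : [disjoint L & S `\` L]%fset.
  by apply/fdisjointP => v vL; rewrite inE vL.
have <- : (L `|` S `\` L)%fset = S.
  apply/fsetP => v; rewrite !inE; case: (boolP (v \in L)) => //= vL.
  by rewrite (fsubsetP LS).
rewrite !hcsum_split //; apply: eq_hcsum => J2 /fsubsetP J2S _.
have J2L v : v \in J2 -> v \notin L by move=> /J2S; rewrite inE => /andP[].
have vE J1 : (J1 `<=` L `\` hit G L J2)%fset ->
    `[< void C (conf (J1 `|` J2)%fset) >] = `[< void C (conf J2) >].
  move=> /fsubsetP J1L; rewrite !void_conf; apply: eq_in_all => v vC.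
  rewrite in_fsetU negb_or; case: (boolP (v \in J1)) => // /J1L.
  by rewrite in_fsetD (negbTE (fdisjointP CL _ vC)) andbF.
have bE J1 : (J1 `<=` L `\` hit G L J2)%fset ->
    blocked G L (conf (J1 `|` J2)%fset) = hit G L J2.
  move=> /fsubsetP J1L; apply/fsetP => v; rewrite !inE; congr (_ && _).
  apply/asboolP/hasP => [[u [uL]]|[u uJ2 Gvu]]; last first.
    by exists u; rewrite J2L // /conf inE uJ2 orbT.
  rewrite /conf inE => /orP[/J1L|uJ2 Gvu]; last by exists u.
  by rewrite in_fsetD (negbTE uL) andbF.
rewrite (@eq_hcsum _ _ _ _ _ _
  (fun=> (`[< void C (conf J2) >])%:R * gam G lam L B (hit G L J2) * 1)); last first.
  by move=> J1 J1L _; rewrite vE // bE // mulr1.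
rewrite hcsumZ -/(hcZ G lam _) /gam -mulrA divfK ?gt_eqF ?hcZ_gt0 // -hcsumZ.
apply: eq_hcsum => J1 J1L _; rewrite vE //; congr (_ * _%:R); congr nat_of_bool.
congr asbool; apply: (sigma_coord_depends sB) => v /= vL; rewrite /conf inE.
by rewrite (negbTE (contraL (J2L v) vL)) orbF.
Qed.


Lemma limit_mean_dlr L C B : sigma_coord [set` L] B -> [disjoint C & L]%fset ->
  limit_mean (fun I => (`[< void C I >])%:R * gam G lam L B (blocked G L I)) =
  limit_mean (fun I => (`[< void C I >])%:R * (`[< B I >])%:R).
Proof.
move=> sB CL; have [n Hn] := initial_exhausts L.
apply: (@eq_limit_mean _ _ n) => [k nk|].
  rewrite /avg finite_dlr //; apply: fsubset_trans Hn _; exact: initial_mono.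
apply: (local2 *%R); first exact: (local_comp (fun P => (`[< P >])%:R) (local_void C)).
apply: (local_comp (fun P => (`[< P >])%:R)).
by exists L; exact: sigma_coord_depends.
Qed.

Lemma local_asbool (T : Type) (h : T -> Prop) (f : config V -> T) : local f ->
  local (fun I => (`[< h (f I) >])%:R : R).
Proof. exact: (local_comp (fun x => (`[< h x >])%:R)). Qed.

Lemma limit_mean_edge u v : G u v ->
  limit_mean (fun I => (`[< I u /\ I v >])%:R) = 0.
Proof.
move=> Guv; rewrite -[RHS](limit_mean_cst 0); congr (limn _); apply/funext => n.
rewrite avg_cst /avg (@eq_hcsum _ _ _ _ _ _ (fun=> 0 * 0)).
  by rewrite hcsumZ !mul0r.
move=> J _ /indepbP iJ; rewrite asboolF ?mulr0 // => -[uJ vJ].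
by have := iJ _ _ uJ vJ; rewrite Guv.
Qed.

Variable mu : probability (config V) R.
Hypothesis muE : forall S : set (config V), local S ->
  mu S = (limit_mean (fun I => (`[< S I >])%:R))%:E.

(** A countable union over the edges, each having both ends occupied with probability 0. *)
Lemma limit_indep_negligible : mu.-negligible (~` indep_sets G).
Proof.
pose E (u v : V) : set (config V) := [set I | G u v /\ (I u /\ I v)].
have dE u v : depends [set` [fset u; v]%fset] (fun I : config V => I u /\ I v).
  by move=> I I' II'; rewrite (II' u) ?(II' v) //= !inE eqxx ?orbT.
have nE u v : mu.-negligible (E u v).
  have [Guv|Guv] := boolP (G u v); last first.
    have -> : E u v = set0 by apply/seteqP; split => // I []; rewrite (negbTE Guv).
    exact: negligible_set0.
  exists [set I : config V | I u /\ I v]; split; last by move=> I [].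
    apply: (@sigma_coord_measurable _ [set` [fset u; v]%fset]).
    exact: depends_sigma_coord (dE u v).
  by rewrite muE ?limit_mean_edge //; exists [fset u; v]%fset.
pose F n : set (config V) :=
  if (choice.unpickle n : option (V * V)) is Some uv then E uv.1 uv.2 else set0.
have nF n : mu.-negligible (F n).
  by rewrite /F; case: choice.unpickle => [[u v]|]; [exact: nE|exact: negligible_set0].
apply: negligibleS (negligible_bigcup nF) => I iI; apply: contrapT => H; apply: iI.
move=> u v Iu Iv; apply/negP => Guv; apply: H.
exists (choice.pickle (u, v)); first exact: Logic.I.
by rewrite /F choice.pickleK.
Qed.

Lemma limit_gibbs_indep : mu (indep_sets G) = 1%E.
Proof.
have mI : measurable (indep_sets G : set (config V)) by exact: (measurable_indep_sets G).
rewrite -[indep_sets G]setCK probability_setC; last exact: measurableC.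
rewrite (measure_negligible _ limit_indep_negligible) ?sube0 //.
exact: measurableC.
Qed.

(** Up to a null set the kernel is a finite combination of indicators of the local events
    [blocked G L I = N], so its integral is a [limit_mean] and [limit_mean_dlr] applies. *)
Lemma limit_gibbs_void L C B : sigma_coord [set` L] B -> [disjoint C & L]%fset ->
  (\int[mu]_(I in void C) hc_measure G lam L (outside L I) B)%E = mu (void C `&` B).
Proof.
move=> sB CL.
have mC : measurable (void C : set (config V)).
  by apply: (@sigma_coord_measurable _ [set` C]); exact: void_sigma.
have mN N : measurable ([set I | blocked G L I = N] : set (config V)).
  apply: (@sigma_coord_measurable _ [set` bd nb L]); apply: depends_sigma_coord.
  by move=> I I' /(blocked_depends Gnb) h; rewrite /= h.
pose r := enum_fset (fpowerset L).
pose c N := gam G lam L B N.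
pose h N I : R := \1_([set I | blocked G L I = N] : set (config V)) I.
have sumE I : c (blocked G L I) = \sum_(N <- r) c N * h N I.
  have bL : blocked G L I \in fpowerset L.
    by rewrite fpowersetE; apply/fsubsetP => v; rewrite inE => /andP[].
  rewrite /r (big_fsetD1 (blocked G L I) bL) /= /h indicE mem_set // mulr1.
  rewrite big_seq big1 ?addr0 // => N; rewrite !inE => /andP[Nb _].
  rewrite indicE memNset ?mulr0 // => Nb'.
  by rewrite Nb' eqxx in Nb.
have c0 N : 0 <= c N by exact: gam_ge0.
have mh N : measurable_fun setT (fun I => (c N * h N I)%:E).
  apply/measurable_EFinP; apply: measurable_funM; first exact: measurable_cst.
  exact: measurable_indic.
transitivity (\int[mu]_(I in void C) (\sum_(N <- r) (c N * h N I)%:E))%E.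
  apply: ae_eq_integral => //.
  - by apply: measurable_funTS; exact: (measurable_hc_measure lam Gsym Gnb sB).
  - apply: measurable_funTS; apply: emeasurable_sum => N; exact: mh.
  apply: negligibleS limit_indep_negligible => I /= H iI; apply: H => _.
  rewrite hc_measureE // asboolT; last first.
    by move=> u v /andP[_ Iu] /andP[_ Iv]; exact: iI.
  by rewrite mul1r sumEFin -sumE.
rewrite ge0_integral_sum //; last 2 first.
- by move=> N; apply: measurable_funTS; exact: mh.
- by move=> N I _; rewrite lee_fin mulr_ge0 // /h indicE.
pose hC N I : R := (`[< void C I /\ blocked G L I = N >])%:R.
have lC N : local (fun I => void C I /\ blocked G L I = N).
  exact: (local2 (fun P N' => P /\ N' = N) (local_void C) (local_blocked L)).
have lhC N : local (hC N) by exact: (local_asbool id (lC N)).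
have intN N : (\int[mu]_(I in void C) (c N * h N I)%:E)%E = (c N * limit_mean (hC N))%:E.
  transitivity (\int[mu]_(I in void C) ((c N)%:E * (h N I)%:E))%E; first by [].
  rewrite ge0_integralZl //; last 3 first.
  - by apply: measurable_funTS; apply/measurable_EFinP; exact: measurable_indic.
  - by move=> I _; rewrite lee_fin /h indicE.
  - by rewrite lee_fin.
  rewrite integral_indic // setIC.
  by rewrite [X in (_ * X)%E](_ : _ = (limit_mean (hC N))%:E) //; exact: (muE (lC N)).
rewrite (eq_bigr (fun N => (c N * limit_mean (hC N))%:E)); last by move=> N _; exact: intN.
rewrite sumEFin.
have [_ <-] := limit_mean_sum r c lhC.
have -> : (fun I => \sum_(N <- r) c N * hC N I) =
    (fun I => (`[< void C I >])%:R * gam G lam L B (blocked G L I)).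
  apply/funext => I; rewrite -/(c _) sumE mulr_sumr; apply: eq_bigr => N _.
  rewrite /hC /h indicE mulrCA; congr (_ * _); rewrite -natrM mulnb; congr (_%:R).
  congr nat_of_bool; apply/asboolP/andP => [[vC bN]|[/asboolP vC /set_mem bN]] //.
  by split; [exact/asboolP|exact: mem_set].
rewrite limit_mean_dlr // muE; last first.
  apply: (local2 and); first exact: local_void.
  by exists L; exact: sigma_coord_depends.
congr ((limit_mean _)%:E); apply/funext => I.
rewrite -natrM mulnb; congr (_%:R); congr nat_of_bool.
by apply/andP/asboolP => [[/asboolP ? /asboolP ?]|[? ?]] //; split; exact/asboolP.
Qed.

Lemma limit_gibbs : hc_gibbs G lam mu.
Proof.
split; first exact: limit_gibbs_indep.
move=> L B sB; split; first apply: (hc_measure_sigma Gsym Gnb sB).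
have mf : measurable_fun setT (fun I : config V => hc_measure G lam L (outside L I) B).
  exact: (measurable_hc_measure lam Gsym Gnb sB).
have f0 I : (0 <= hc_measure G lam L (outside L I) B)%E by exact: hc_measure_ge0.
have mB : measurable (B : set (config V)) by exact: sigma_coord_measurable sB.
apply: sigma_coord_ind.
- move=> C CL; apply: limit_gibbs_void => //; apply/fdisjointP => v vC.
  by apply/negP => vL; exact: (CL v vC vL).
- move=> S sS IH; have mS : measurable (S : set (config V)).
    exact: sigma_coord_measurable sS.
  have mCS : measurable (~` S : set (config V)) by exact: measurableC.
  (* The case of empty [C] gives the equation on the whole space; the one for [S] is subtracted from
     it, all masses being finite. *)
  have IT : (\int[mu]_(I in setT) hc_measure G lam L (outside L I) B)%E = mu B.
    rewrite -[in RHS](setTI B) -void0; apply: limit_gibbs_void => //.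
    exact: fdisjoint0X.
  have split1 : (\int[mu]_(I in S) hc_measure G lam L (outside L I) B +
      \int[mu]_(I in ~` S) hc_measure G lam L (outside L I) B = mu B)%E.
    rewrite -IT -(setUv S) ge0_integral_setU ?setUv //.
    by rewrite disj_set2E setICr.
  have split2 : (mu (S `&` B) + mu (~` S `&` B) = mu B)%E.
    rewrite -measureU //.
    + by rewrite -setIUl setUv setTI.
    + exact: measurableI.
    + exact: measurableI.
    + by rewrite setIACA setICr set0I.
  have fin : mu (S `&` B) \is a fin_num by apply: fin_num_measure; exact: measurableI.
  move: split1; rewrite IH -split2 addeC => /(congr1 (fun x => x - mu (S `&` B))%E).
  by rewrite addeK // [X in (X - _)%E]addeC addeK.
- move=> F sF tF IH; have mF n : measurable (F n : set (config V)).
    exact: sigma_coord_measurable (sF n).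
  rewrite ge0_integral_bigcup //; last exact: measurable_funTS.
  rewrite setI_bigcupl measure_bigcup //.
  + rewrite [RHS](eq_eseriesl (Q := xpredT)); last by move=> n; rewrite in_setT.
    by apply: eq_eseriesr => n _; exact: IH.
  + by move=> n _; exact: measurableI.
  + exact: trivIset_setIr.
Qed.

End gibbs_existence.

(** * Uniqueness on the percolation graph *)

Section gibbs_criterion.
Local Open Scope ring_scope.
Variables (R : realType) (V : countType) (G : rel V) (lam : R).
Hypotheses (Gsym : symmetric G) (Girr : irreflexive G) (lam0 : 0 <= lam).

Lemma hc_gibbs_singleton_of_conv (nb : V -> {fset V}) :
  (forall u w, G u w -> w \in nb u) ->
  (forall (A : {fset V}) (eps : R), 0 < eps ->
    exists Lam, forall S S', (Lam `<=` S)%fset -> (Lam `<=` S')%fset ->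
      `|hcr G lam S A - hcr G lam S' A| <= eps) ->
  hc_gibbs_singleton G lam.
Proof.
move=> Gnb conv.
have [mu muE] := kolmogorov_extension
  (limit_mean_ge0 lam0 conv) (limit_meanD conv) (limit_mean_cst Gsym Girr lam0 1).
exists mu; first exact: (limit_gibbs Gsym Girr lam0 Gnb conv muE).
move=> nu gnu; apply: (gibbs_unique Gsym Girr lam0 Gnb conv _ gnu).
exact: (limit_gibbs Gsym Girr lam0 Gnb conv muE).
Qed.

(* Telescoping: [hcr S A] is a product of ratios [hcq (S `\` F) a]. *)
Lemma hcr_conv_of_hcq :
  (forall (F : {fset V}) v (eps : R), 0 < eps ->
    exists Lam, forall S S', (Lam `<=` S)%fset -> (Lam `<=` S')%fset ->
      `|hcq G lam (S `\` F)%fset v - hcq G lam (S' `\` F)%fset v| <= eps) ->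
  forall (A : {fset V}) (eps : R), 0 < eps ->
    exists Lam, forall S S', (Lam `<=` S)%fset -> (Lam `<=` S')%fset ->
      `|hcr G lam S A - hcr G lam S' A| <= eps.
Proof.
move=> Hq A eps e0.
(* Peeling off a vertex changes the ambient set, so the induction is over all sets [F] deleted so
   far. *)
suff [Lam H] : exists Lam, forall S S', (Lam `<=` S)%fset -> (Lam `<=` S')%fset ->
    `|hcr G lam (S `\` fset0)%fset A - hcr G lam (S' `\` fset0)%fset A| <= eps.
  by exists Lam => S S' LS LS'; have := H S S' LS LS'; rewrite !fsetD0.
elim/fset1U_rect: A (fset0 : {fset V}) eps e0 => [|a A _ IH] F eps e0.
  by exists fset0 => S S' _ _; rewrite !hcr0 // subrr normr0 ltW.
have e2 : 0 < eps / 2 by rewrite divr_gt0.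
have [L1 H1] := Hq F a _ e2; have [L2 H2] := IH (F `|` [fset a])%fset _ e2.
exists (L1 `|` L2)%fset => S S'; rewrite !fsubUset => /andP[S1 S2] /andP[S1' S2'].
rewrite !hcrU1 // !fsetDDl.
have := H1 S S' S1 S1'; have := H2 S S' S2 S2'.
set q := hcq _ _ _ _; set q' := hcq _ _ _ _; set b := hcr _ _ _ _; set b' := hcr _ _ _ _.
move=> h2 h1.
have q01 : 0 <= q <= 1 by rewrite hcq_le1 // ltW // hcq_gt0.
have b01 : 0 <= b' <= 1 by rewrite hcr_le1 // ltW // hcr_gt0.
have -> : q * b - q' * b' = q * (b - b') + (q - q') * b' by ring.
rewrite (splitr eps) (le_trans (ler_normD _ _)) // lerD // normrM.
  by case/andP: q01 => ? ?; rewrite (le_trans _ h2) // ler_piMl // ger0_norm.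
by case/andP: b01 => ? ?; rewrite (le_trans _ h1) // ler_piMr // ger0_norm.
Qed.

End gibbs_criterion.

(** * The graph of open vertices *)

Section percolation_graph.
Local Open Scope fset_scope.
Local Open Scope ring_scope.
Variables (R : realType) (lam : R) (x : int * int -> bool).
Hypothesis lam0 : 0 <= lam.
Local Notation V := {v : int * int | x v}.

Definition lift_open (U : {fset int * int}) : {fset V} :=
  [fset v in (pmap insub (enum_fset U) : seq V)].

Lemma mem_lift_open U (v : V) : (v \in lift_open U) = (val v \in U).
Proof. by rewrite inE mem_pmap_sub. Qed.

Lemma Gp_sym : symmetric (@Gp x).
Proof. by move=> u v; rewrite /Gp Z2adj_sym. Qed.

Lemma Gp_irr : irreflexive (@Gp x).
Proof. by move=> u; rewrite /Gp Z2adj_irr. Qed.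

Lemma Gp_nbrs (u w : V) : Gp u w -> w \in lift_open (box (val u) 1).
Proof.
rewrite mem_lift_open => uw.
by have [_ nW] := nbd_box (val u) 0; apply: nW uw; exact: box_center.
Qed.

Hypothesis disagreement : forall v, x v -> forall eps, 0 < eps ->
  exists r, dsc lam r v (open_sites x (box v r.+1)) < eps.

(** [Lam] consists of the open vertices of a box around [v] where the disagreement is below [eps]
    divided by [1 + lam] to the power of the size of [F], so as to absorb the factor in
    [hcq_removal_disc]. *)
Lemma Gp_hcq_conv (F : {fset V}) (v : V) (eps : R) : 0 < eps ->
  exists Lam, forall S S' : {fset V}, Lam `<=` S -> Lam `<=` S' ->
    `|hcq (@Gp x) lam (S `\` F) v - hcq (@Gp x) lam (S' `\` F) v| <= eps.
Proof.
move=> e0; have [vF|vF] := boolP (v \in F).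
  have q1 (S0 : {fset V}) : hcq (@Gp x) lam (S0 `\` F) v = 1.
    by apply: (hcq_notin Gp_sym Gp_irr lam0); rewrite in_fsetD vF.
  by exists fset0 => S S' _ _; rewrite !q1 subrr normr0 ltW.
have L0 : 0 < (1 + lam) ^+ #|` F| by rewrite exprn_gt0 // ltr_wpDr.
have [r hr] := disagreement (valP v) (divr_gt0 e0 L0).
exists (lift_open (box (val v) r)) => S S' LS LS'.
have valE (S0 : {fset V}) : hcq (@Gp x) lam (S0 `\` F) v =
    hcq Z2adj lam (val @` S0 `\` val @` F) (val v).
  rewrite -imfsetD_inj; last exact: val_inj.
  by rewrite (hcq_imfset lam Gp_sym Gp_irr Z2adj_sym Z2adj_irr (@val_inj _ _ _)).
rewrite !valE.
(* [X] consists of open vertices and contains both sets and all open vertices near [v]; its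
   disagreement is that of the percolation, as [dsc] only sees the box of radius [r + 1]. *)
pose X := val @` S `|` val @` S' `|` open_sites x (box (val v) r.+1).
have Xx u : u \in X -> x u.
  rewrite !in_fsetU => /orP[/orP[]|]; last by rewrite mem_open_sites => /andP[].
    by move=> /imfsetP[w _ ->]; exact: valP.
  by move=> /imfsetP[w _ ->]; exact: valP.
have dX : dsc lam r (val v) X < eps / (1 + lam) ^+ #|` F|.
  rewrite dsc_local (_ : X `&` _ = open_sites x (box (val v) r.+1)) //.
  apply/fsetP => u; apply/fsetIP/idP => [[/Xx xu ub]|uo]; first by rewrite mem_open_sites ub.
  split; first by apply/fsetUP; right.
  by move: uo; rewrite mem_open_sites => /andP[].
have LX (S0 : {fset V}) : lift_open (box (val v) r) `<=` S0 ->
    box (val v) r `&` X `<=` val @` S0.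
  move=> /fsubsetP LS0; apply/fsubsetP => u; rewrite inE => /andP[ub /Xx xu].
  by apply/imfsetP; exists (Sub u xu); rewrite ?SubK //; apply: LS0; rewrite mem_lift_open SubK.
have SX : val @` S `<=` X by apply/fsubsetP => u uS; rewrite !in_fsetU uS.
have SX' : val @` S' `<=` X by apply/fsubsetP => u uS; rewrite !in_fsetU uS orbT.
have vX : val v \in X.
  by apply/fsetUP; right; rewrite mem_open_sites box_center; exact: valP.
have vF' : val v \notin val @` F by rewrite mem_imfset //; exact: val_inj.
have cF : #|` val @` F| = #|` F| by apply: card_imfset; exact: val_inj.
have main S1 S2 : box (val v) r `&` X `<=` S1 -> S1 `<=` X ->
    box (val v) r `&` X `<=` S2 -> S2 `<=` X ->
    hcq Z2adj lam (S1 `\` val @` F) (val v) - hcq Z2adj lam (S2 `\` val @` F) (val v) <= eps.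
  move=> h1 h2 h3 h4.
  apply: le_trans (hcq_removal_disc Z2adj_sym Z2adj_irr lam0 Z2adj_parity
    (nbd_box (val v) r) (box_center _ _) vX vF' h1 h2 h3 h4) _.
  by rewrite cF mulrC -ler_pdivlMr // ltW.
rewrite ler_norml; apply/andP; split; last by apply: main => //; exact: LX.
by rewrite lerNl opprB; apply: main => //; exact: LX.
Qed.

Lemma Gp_gibbs_singleton : hc_gibbs_singleton (@Gp x) lam.
Proof.
apply: (hc_gibbs_singleton_of_conv Gp_sym Gp_irr lam0 Gp_nbrs).
exact: (hcr_conv_of_hcq Gp_sym Gp_irr lam0 Gp_hcq_conv).
Qed.

End percolation_graph.

Theorem theorem1p1 (R : realType) (lambda p : R)
    (hlambda : 0 <= lambda) (hp : 0 <= p < 1)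
    (d : measure_display) (Omega : measurableType d)
    (P : probability Omega R) (X : int * int -> {RV P >-> bool})
    (hX : bernoulli_percolation p X) :
  {ae P, forall w, hc_gibbs_singleton (@Gp (fun v => X v w)) lambda}.
Proof.
apply: filterS (perc_disagreement hlambda hp hX) => w Hw.
exact: Gp_gibbs_singleton.
Qed.
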